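(* Let $\Lambda=(V,E)$ be a finite graph, let $A,B\in\mathcal M(\Lambda)$, and let $\mathbf n_1,\mathbf n_2\in\mathbb N^E$ satisfy $\partial\mathbf n_1=\partial A$ and $\partial\mathbf n_2=\partial B$. Let $a>0$ and $x\in V$. As $g$ tends to $0$ (with $g>0$), the probability measure $\rho^{\mathbf n_1,\mathbf n_2}_{x,A,B,g,a}$ converges in distribution to $U^{\mathbf n_1,\mathbf n_2}_{x,A,B}$, the uniform measure on the pairings belonging to $\mathcal T_{\mathbf n,A,B}(x)$, where $\mathbf n=\mathbf n_1+\mathbf n_2$.
   Context: **Currents on the complete graph.** For $n\ge1$ let $K_n$ be the complete graph on $V_n=\{1,\dots,n\}$ with edge set $\mathcal P_2(V_n)$ (unordered pairs of distinct vertices). For $\lambda\in\mathbb R$ put $d_n(\lambda)=\frac1n\left(1-\frac{\lambda}{\sqrt n}\right)$, with $n$ large enough that $d_n(\lambda)>0$. A current on $K_n$ is a function $\mathbf m:\mathcal P_2(V_n)\to\mathbb N=\{0,1,\dots\}$, with source set $\partial\mathbf m=\{u\in V_n:\sum_{v\ne u}\mathbf m_{u,v}\text{ odd}\}$ and weight $w(\mathbf m)=\prod_{\{i,j\}}\frac{d_n(\lambda)^{\mathbf m_{i,j}}}{\mathbf m_{i,j}!}$. For $S\subset V_n$ of even cardinality, $\mathbb P^S_{n,\lambda}$ is the probability measure on currents with $\mathbb P^S_{n,\lambda}[\mathbf m]\propto w(\mathbf m)\mathbf 1[\partial\mathbf m=S]$, and $\mathbb P^{S_1,S_2}_{n,\lambda}=\mathbb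 P^{S_1}_{n,\lambda}\otimes\mathbb P^{S_2}_{n,\lambda}$ is the law of a pair of independent currents $(\mathbf m_1,\mathbf m_2)$. For $S_1,S_2$ disjoint sets of even cardinality, $\mathcal P_{\mathrm{even}}(S_1,S_2)$ is the set of partitions $\{P_1,\dots,P_r\}$ of $S_1\sqcup S_2$ such that $|P_i\cap S_1|$ and $|P_i\cap S_2|$ are even for every $i$. Let $\tilde\rho^{S_1,S_2}_{n,\lambda}$ be the law on $\mathcal P_{\mathrm{even}}(S_1,S_2)$ of the partition $\mathfrak P(\mathbf m_1+\mathbf m_2)$ of $S_1\sqcup S_2$ under $\mathbb P^{S_1,S_2}_{n,\lambda}$, where two elements are in the same block iff they are joined by a path of edges $e$ with $(\mathbf m_1+\mathbf m_2)_e>0$. For fixed $S_1,S_2,\lambda$ these measures converge as $n\to\infty$; the limit depends on $S_1,S_2$ only through their cardinalities, up to relabelling. **Blocks and tanglings on $\Lambda$.** $\mathcal M(\Lambda)=\{A\in\mathbb N^V:\sum_{x\in V}A_x\text{ is even}\}$ and $\partial A=\{x\in V:A_x\text{ odd}\}$. For a current $\mathbf n\in\mathbb N^E$ on $\Lambda$ (with $\mathbf n_{x,y}=0$ if $\{x,y\}\notin E$), $\Delta_{\mathbf n}(x)=\sum_{y}\mathbf n_{x,y}$ and $\partial\mathbf n=\{x\in V:\Delta_{\mathbf n}(x)\text{ odd}\}$. For $x\in V$, the block $\mathcal B_x(\mathbf n_1,A)$ is a set of $\Delta_{\mathbf n_1}(x)+A_x$ labelled points: $\mathbf n_1(x,y)$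 points for each $y\in V$, and $A_x$ further points; $\mathcal B_x(\mathbf n_2,B)$ is defined similarly. With $\mathbf n=\mathbf n_1+\mathbf n_2$, the block $\mathcal B_x(\mathbf n,A,B)$ consists of $\mathbf n_{x,y}$ points for each $y$, $A_x$ points associated with $A$ and $B_x$ points associated with $B$; via the natural injections it is identified with the disjoint union $\mathcal B_x(\mathbf n_1,A)\sqcup\mathcal B_x(\mathbf n_2,B)$. $\mathcal T_{\mathbf n,A,B}(x)$ is the set of partitions $\{P_1,\dots,P_r\}$ of $\mathcal B_x(\mathbf n,A,B)$ such that $|P_i\cap\mathcal B_x(\mathbf n_1,A)|$ and $|P_i\cap\mathcal B_x(\mathbf n_2,B)|$ are even for every $i$. A pairing is a partition all of whose blocks have exactly two elements. **The measures $\rho$.** For $g>0$ and $a\in\mathbb R$ put $\tilde g=(12g)^{1/4}$ and $\lambda=2a\tilde g^{-2}$. The probability measure $\rho^{\mathbf n_1,\mathbf n_2}_{x,A,B,g,a}$ on $\mathcal T_{\mathbf n,A,B}(x)$ is the limit as $n\to\infty$ of $\tilde\rho^{S_1,S_2}_{n,\lambda}$, where $S_1,S_2$ are disjoint with $|S_1|=A_x+\Delta_{\mathbf n_1}(x)$ and $|S_2|=B_x+\Delta_{\mathbf n_2}(x)$ (both even), transported by bijections $S_1\cong\mathcal B_x(\mathbf n_1,A)$ and $S_2\cong\mathcal B_x(\mathbf n_2,B)$ (the result does not depend on the choice of bijections). *)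

(* Defs.v *)
From HB Require Import structures.
From mathcomp Require Import all_boot all_order all_algebra.
From mathcomp Require Import all_classical all_reals all_analysis.

Set Implicit Arguments.
Unset Strict Implicit.
Unset Printing Implicit Defensive.

Import Order.TTheory GRing.Theory Num.Theory.
Import numFieldNormedType.Exports.

Local Open Scope ring_scope.

(** * Graphs and currents *)

(* The set of unordered pairs of distinct vertices.  A finite graph with vertex
   type [V] is given by its edge set [E \subset pairs V]. *)
Definition pairs (V : finType) : {set {set V}} := [set e : {set V} | #|e| == 2%N].

Definition edge (V : finType) (E : {set {set V}}) : finType :=
  {e : {set V} | e \in E}.

Definition current (V : finType) (E : {set {set V}}) : choiceType :=
  {ffun edge E -> nat}.

Section Currents.
Context {V : finType} {E : {set {set V}}}.
Implicit Types m : current E.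

(* m_{x,y}, with the convention m_{x,y} = 0 when {x,y} is not an edge. *)
Definition mult m (x y : V) : nat :=
  if insub [set x; y] is Some e then m e else 0%N.

Definition degree m (x : V) : nat := (\sum_(y : V) mult m x y)%N.

Definition addc m1 m2 : current E := [ffun e => (m1 e + m2 e)%N].

Definition linked m : rel V := fun x y => (0 < mult m x y)%N.

(* The partition of [S] induced by the clusters of [m]. *)
Definition cluster_partition m (S : {set V}) : {set {set V}} :=
  equivalence_partition (connect (linked m)) S.

End Currents.

(* The boundary of a function A in N^V. *)
Definition bdry (V : finType) (A : V -> nat) : {set V} := [set x | odd (A x)].

Definition sources (V : finType) (E : {set {set V}}) (m : current E) : {set V} :=
  bdry (degree m).

(* The set M(Lambda). *)
Definition even_total (V : finType) (A : V -> nat) : bool :=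
  ~~ odd (\sum_(x : V) A x)%N.

(** * Partitions *)

(* The set P_even(S1, S2) for disjoint [S1], [S2]. *)
Definition even_partitions (T : finType) (S1 S2 : {set T}) : {set {set {set T}}} :=
  [set p : {set {set T}} | finset.partition p (S1 :|: S2) &
     [forall P in p, ~~ odd #|P :&: S1| && ~~ odd #|P :&: S2|]].

Definition is_pairing (T : finType) (p : {set {set T}}) : bool :=
  [forall P in p, #|P| == 2%N].

(** * Convergence in distribution on a finite set *)

(* Measures on a finite type are given by their point masses; every real
   function on a finite (discrete) space is bounded and continuous. *)
Definition expect (R : realType) (X : finType) (mu : X -> R) (phi : X -> R) : R :=
  \sum_(t : X) mu t * phi t.

Definition cvg_in_distribution (R : realType) (X : finType) (I : Type)
    (F : set_system I) (mu_ : I -> X -> R) (mu : X -> R) : Prop :=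
  forall phi : X -> R,
    ((fun i => expect (mu_ i) phi) @ F --> expect mu phi)%classic.

(** * Currents on the complete graph *)

Section CompleteGraph.
Context {R : realType}.

(* The vertices 1, ..., n of K_n are represented by 0, ..., n - 1. *)
Definition Kcurrent (n : nat) : choiceType := current (pairs 'I_n).

Definition dn (n : nat) (lambda : R) : R :=
  n%:R^-1 * (1 - lambda / Num.sqrt n%:R).

Definition weight (n : nat) (lambda : R) (m : Kcurrent n) : R :=
  \prod_e (dn n lambda ^+ m e / (m e)`!%:R).

Definition partition_function (n : nat) (lambda : R) (S : {set 'I_n}) : R :=
  fine (\esum_(m in [set m : Kcurrent n | sources m = S]%classic)
          (weight lambda m)%:E).

(* The point masses of P^S_{n,lambda}. *)
Definition current_prob (n : nat) (lambda : R) (S : {set 'I_n})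
    (m : Kcurrent n) : R :=
  if sources m == S then weight lambda m / partition_function lambda S else 0.

(* The point masses of P^{S1,S2}_{n,lambda}. *)
Definition current2_prob (n : nat) (lambda : R) (S1 S2 : {set 'I_n})
    (m : Kcurrent n * Kcurrent n) : R :=
  current_prob lambda S1 m.1 * current_prob lambda S2 m.2.

(* The point masses of the law of the partition of S1 U S2 induced by the
   clusters of m1 + m2 under P^{S1,S2}_{n,lambda}. *)
Definition rho_tilde (n : nat) (lambda : R) (S1 S2 : {set 'I_n})
    (p : {set {set 'I_n}}) : R :=
  fine (\esum_(m in [set m : Kcurrent n * Kcurrent n |
                      cluster_partition (addc m.1 m.2) (S1 :|: S2) = p]%classic)
          (current2_prob lambda S1 S2 m)%:E).

End CompleteGraph.

(** * Blocks, tanglings and the measures rho and U *)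

Section Tanglings.
Context {V : finType} {E : {set {set V}}}.
Variables (n1 n2 : current E) (A B : V -> nat) (x : V).

Definition block (m : current E) (C : V -> nat) : finType :=
  ({y : V & 'I_(mult m x y)} + 'I_(C x))%type.

(* The block B_x(n1 + n2, A, B), as the disjoint union of B_x(n1, A) and
   B_x(n2, B). *)
Definition block2 : finType := (block n1 A + block n2 B)%type.

Definition block_left : {set block2} := [set inl t | t : block n1 A].
Definition block_right : {set block2} := [set inr t | t : block n2 B].

Definition tangling : finType :=
  {p : {set {set block2}} | p \in even_partitions block_left block_right}.

(* [iota] places the points of the block at distinct vertices of the complete
   graphs.  For a set [P] of points, [place iota n P] is its image in V_n; it is
   faithful once n exceeds all the values of [iota]. *)
Definition place (iota : block2 -> nat) (n : nat) (P : {set block2}) :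
    {set 'I_n} :=
  [set v : 'I_n | [exists t in P, iota t == v]].

Definition rho_n (R : realType) (iota : block2 -> nat) (lambda : R) (n : nat)
    (t : tangling) : R :=
  rho_tilde lambda (place iota n block_left) (place iota n block_right)
    (place iota n @: val t).

Definition lambda_ga (R : realType) (g a : R) : R :=
  let g_tilde := (12 * g) `^ 4^-1 in 2 * a * g_tilde ^- 2.

(* [mu] is the measure rho^{n1,n2}_{x,A,B,g,a}: the limit in n of the laws
   rho_tilde for fixed disjoint S1, S2 identified with B_x(n1, A), B_x(n2, B).
   The choice of [iota] is immaterial, as the weights are invariant under
   relabelling of the vertices of K_n. *)
Definition is_rho (R : realType) (g a : R) (mu : tangling -> R) : Prop :=
  exists2 iota : block2 -> nat, injective iota &
    cvg_in_distribution \oo%classic (rho_n iota (lambda_ga g a)) mu.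

Definition uniform_pairing (R : realType) (t : tangling) : R :=
  if is_pairing (val t) then #|[set s : tangling | is_pairing (val s)]|%:R^-1
  else 0.

End Tanglings.

(* Main.v *)
Require Import Defs.
From mathcomp Require Import all_boot all_order all_algebra all_fingroup.
From mathcomp Require Import all_classical all_reals all_analysis.
From mathcomp Require Import ring lra zify fintype finset.
Import Order.TTheory GRing.Theory Num.Theory.
Import numFieldNormedType.Exports.
Set Implicit Arguments.
Unset Strict Implicit.
Unset Printing Implicit Defensive.
Local Open Scope ring_scope.

(** As [g -> 0] the parameter [lambda] tends to infinity, so the point is that for
    large [lambda], uniformly in [n] large, the partition is a pairing with
    probability close to 1; by exchangeability of the vertices all even pairings
    have the same probability.

    Let [Z_j] be the weight of the currents with [j] sources.  Counting the edges at
    a source [x], whose degree [D] is odd, and using [1 <= D] and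
    [D - 1 <= D (D - 1) / 3], gives two-sided bounds showing that
    [Z_(j+2) = (j + 1) c Z_j (1 + o(1))] with [c = 1 / (lambda sqrt n)]: the [Z_j] are
    asymptotically the moments of a Gaussian.

    A multigraph [m] with even clusters splits as [m1 + m2] with sources of [m1] equal
    to [T] in the same number of ways for each [T] meeting all clusters evenly, which
    a Fourier expansion in spins makes transparent.  If [m] has [2k] sources [S], there
    are at least [2^k] such [T] inside [S], and at least [2^(k+1)] if the clusters do
    not pair up [S].  Hence [2^k] times the weight of the non-pairing configurations is
    at most [sum_(T in S) Z_|T| Z_|S - T| - 2^k Z_2k Z_0], and this difference is
    negligible because it vanishes for Gaussian moments. *)

(** * Sums of nonnegative functions over a countable type *)

Section Mass.
Context {R : realType}.

(** Values in the extended reals let sums be split, scaled and reindexed before anything is known to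
    be finite. *)
Definition mass (X : choiceType) (f : X -> R) : \bar R :=
  (\esum_(x in [set: X]) (f x)%:E)%classic.

Variable X : choiceType.
Implicit Types f g : X -> R.

Lemma mass_ge0 f : (forall x, 0 <= f x) -> (0 <= mass f)%E.
Proof. by move=> f0; apply: esum_ge0 => x _; rewrite lee_fin. Qed.

Lemma le_mass f g : (forall x, f x <= g x) -> (mass f <= mass g)%E.
Proof. by move=> fg; apply: le_esum => x _; rewrite lee_fin. Qed.

Lemma eq_mass f g : f =1 g -> mass f = mass g.
Proof. by move=> fg; apply: eq_esum => x _; rewrite fg. Qed.

Lemma mass_const0 : mass (fun _ : X => 0) = 0%E.
Proof. exact: esum1. Qed.

Lemma massD f g : (forall x, 0 <= f x) -> (forall x, 0 <= g x) ->
  mass (fun x => f x + g x) = (mass f + mass g)%E.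
Proof.
move=> f0 g0; rewrite /mass -esumD; do ?by move=> x _; rewrite lee_fin.
by apply: eq_esum => x _; rewrite EFinD.
Qed.

Lemma mass_sum (I : eqType) (r : seq I) (P : pred I) (F : I -> X -> R) :
  (forall i x, 0 <= F i x) ->
  mass (fun x => \sum_(i <- r | P i) F i x) = (\sum_(i <- r | P i) mass (F i))%E.
Proof.
move=> F0; elim: r => [|i r IH].
  by rewrite big_nil -mass_const0; apply: eq_mass => x; rewrite big_nil.
rewrite big_cons -IH; case: ifP => Pi; last by apply: eq_mass => x; rewrite big_cons Pi.
rewrite -massD //; first by apply: eq_mass => x; rewrite big_cons Pi.
by move=> x; apply: sumr_ge0.
Qed.

Lemma massZ c f : 0 <= c -> (forall x, 0 <= f x) ->
  mass (fun x => c * f x) = (c%:E * mass f)%E.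
Proof.
move=> c0 f0; rewrite /mass /esum -ereal_supZl //; last first.
  by apply/set0P; exists 0%E; exists classical_sets.set0; [exact: fsets_set0 | rewrite fsbig_set0].
congr ereal_sup; apply/seteqP; split => y /=.
  case=> A [fA sA] <-.
  exists (\sum_(x \in A) (f x)%:E)%E; first by exists A.
  by rewrite !fsbig_finite //= !sumEFin -EFinM mulr_sumr.
case=> z [A [fA sA] <-] <-; exists A => //.
by rewrite !fsbig_finite //= !sumEFin -EFinM mulr_sumr.
Qed.

Lemma mass_reindex (Y : choiceType) (h : Y -> X) f : bijective h ->
  mass f = mass (f \o h).
Proof. by move=> bh; apply: reindex_esum; rewrite setTT_bijective. Qed.

Lemma mass_pair (Y : choiceType) (h : X * Y -> R) : (forall z, 0 <= h z) ->
  mass h = (\esum_(x in [set: X]) mass (fun y => h (x, y)))%classic%E.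
Proof.
move=> h0; rewrite /mass esum_esum; last by move=> x y _ _; rewrite lee_fin.
have -> : ([set: X] `*`` (fun=> [set: Y]) = classical_sets.setT)%classic by apply/seteqP; split.
by apply: eq_esum => -[x y].
Qed.

End Mass.

(** Fubini; finiteness of [mass g] allows the inner sum to be pulled out as a real scalar. *)
Lemma mass_mul (R : realType) (X Y : choiceType) (f : X -> R) (g : Y -> R) :
  (forall x, 0 <= f x) -> (forall y, 0 <= g y) -> mass g \is a fin_num ->
  mass (fun z => f z.1 * g z.2) = (mass f * mass g)%E.
Proof.
move=> f0 g0 gfin; rewrite mass_pair; last by move=> z; apply: mulr_ge0.
transitivity (mass (fun x => fine (mass g) * f x)).
  by apply: eq_esum => x _ /=; rewrite massZ // mulrC EFinM fineK.
by rewrite massZ ?fine_ge0 ?mass_ge0 // fineK // muleC.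
Qed.

(** * Currents on a complete graph *)

(** Symmetric difference: source sets combine in this way when currents are added. *)
Definition sdiff (T : finType) (A B : {set T}) : {set T} :=
  [set x | (x \in A) (+) (x \in B)].

Section Currents.
Variable V : finType.
Notation E := (pairs V).
Notation cur := (current E).
Implicit Types (m : cur) (e : edge E).

Lemma card_edge e : #|val e| = 2%N.
Proof. by have := valP e; rewrite inE => /eqP. Qed.

(** The sum has at most one term. In this form degrees become sums over incident edges, and
    summations over edges and vertices can be exchanged. *)
Lemma mult_edgesE m x y : mult m x y = (\sum_(e : edge E | val e == [set x; y]) m e)%N.
Proof.
rewrite /mult; case: insubP => [e _ <-|nxy].
  by rewrite (big_pred1 e).
rewrite big_pred0 // => e; apply/negP => /eqP h.
by move: nxy; rewrite -h (valP e).
Qed.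

Lemma mult_sym m x y : mult m x y = mult m y x.
Proof. by rewrite !mult_edgesE setUC. Qed.

Lemma edge_other_end e x : x \in val e ->
  exists2 y, y != x & forall z, (val e == [set x; z]) = (z == y).
Proof.
move=> xe; have : #|val e :\ x| == 1%N.
  by rewrite -(eqn_add2l 1) eq_sym -[(1 + 1)%N](card_edge e) [X in X == _](cardsD1 x) xe.
move=> /cards1P[y hy].
have exy : val e = [set x; y] by rewrite -(setD1K xe) hy.
have yx : y != x by have : y \in val e :\ x; [rewrite hy set11 | rewrite !inE => /andP[]].
exists y => // z; rewrite exy; apply/eqP/eqP => [h|->//].
have : y \in [set x; z] by rewrite -h set22.
by rewrite !inE (negPf yx) /= => /eqP ->.
Qed.

Lemma sum_edges_at (M : nmodType) x (F : {set V} -> M) :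
  \sum_(e : edge E | x \in val e) F (val e) = \sum_(y | y != x) F [set x; y].
Proof.
rewrite (eq_bigr (fun y => \sum_(e : edge E | val e == [set x; y]) F (val e))); last first.
  move=> y yx.
  have pxy : [set x; y] \in pairs V by rewrite inE cards2 [x == y]eq_sym yx.
  by rewrite (big_pred1 (Sub [set x; y] pxy)) //= => e; rewrite -val_eqE.
rewrite (exchange_big_dep xpredT) // big_mkcond; apply: eq_bigr => e _.
case: ifPn => [xe|nxe].
  have [y yx hy] := edge_other_end xe.
  rewrite (big_pred1 y) // => z; rewrite hy /=.
  by apply: andb_idl => /eqP ->.
rewrite big_pred0 // => y; apply/negP => /andP[_ /eqP h].
by move: nxe; rewrite h set21.
Qed.

Lemma degreeE m x : degree m x = (\sum_(e : edge E | x \in val e) m e)%N.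
Proof.
rewrite /degree; under eq_bigr do rewrite mult_edgesE big_mkcond.
rewrite exchange_big [RHS]big_mkcond; apply: eq_bigr => e _.
rewrite -big_mkcond; case: ifPn => [xe|nxe].
  by have [y _ hy] := edge_other_end xe; rewrite (big_pred1 y).
rewrite big_pred0 // => y; apply/negP => /eqP h.
by move: nxe; rewrite h set21.
Qed.

Lemma in_sources m x : (x \in sources m) = odd (degree m x).
Proof. by rewrite inE. Qed.

Lemma linkedP m x y : reflect (exists2 e, val e = [set x; y] & (0 < m e)%N) (linked m x y).
Proof.
rewrite /linked mult_edgesE; apply: (iffP idP) => [|[e ee me]].
  rewrite lt0n sum_nat_eq0 negb_forall => /existsP[e].
  by rewrite negb_imply -lt0n => /andP[/eqP ? ?]; exists e.
by rewrite (bigD1 e) ?ee //= addn_gt0 me.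
Qed.

Lemma linked_sym m : symmetric (linked m).
Proof. by move=> x y; rewrite /linked mult_sym. Qed.

Lemma connect_linked_sym m : connect_sym (linked m).
Proof. exact/sym_connect_sym/linked_sym. Qed.

Lemma linked_equiv m : equivalence_rel (connect (linked m)).
Proof.
apply/equivalence_relP; split => [x|x y xy z]; first exact: connect0.
by apply/idP/idP; apply: connect_trans; rewrite // connect_linked_sym.
Qed.

(* Every edge carrying current has both or none of its ends in a union of clusters. *)
Lemma odd_sources_closed m (C : {set V}) :
  (forall x y, linked m x y -> x \in C -> y \in C) -> ~~ odd #|C :&: sources m|.
Proof.
move=> clC.
have -> : odd #|C :&: sources m| = odd (\sum_(x in C) degree m x).
  rewrite -sum1_card (big_morph odd oddD (erefl _)) [RHS](big_morph odd oddD (erefl _)).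
  rewrite big_mkcond [RHS]big_mkcond; apply: eq_bigr => x _.
  by rewrite inE in_sources; case: (x \in C) => //=; case: odd.
under eq_bigr do rewrite degreeE big_mkcond.
rewrite exchange_big (big_morph odd oddD (erefl _)) big1 // => e _.
rewrite -big_mkcondr sum_nat_const oddM.
have [->|me] := posnP (m e); first by rewrite andbF.
have /cards2P[a [b [ab eE]]] := introT eqP (card_edge e).
have lab : linked m a b by apply/linkedP; exists e.
have lba : linked m b a by rewrite linked_sym.
have abC : (a \in C) = (b \in C) by apply/idP/idP; apply: clC.
have -> : #|(fun x => (x \in C) && (x \in val e))| = #|C :&: val e|.
  by apply: eq_card => x; rewrite inE.
case bC: (b \in C).
  suff -> : C :&: val e = val e by rewrite card_edge.
  by apply/setIidPr/subsetP => x; rewrite eE !inE => /orP[]/eqP->; rewrite ?abC.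
suff -> : C :&: val e = set0 by rewrite cards0.
apply/setP => x; rewrite eE !inE; apply/negP => /andP[xC /orP[]/eqP h].
  by rewrite h abC bC in xC.
by rewrite h bC in xC.
Qed.

Lemma even_card_sources m : ~~ odd #|sources m|.
Proof. by rewrite -(setTI (sources m)); apply: odd_sources_closed => x y; rewrite !inE. Qed.

Lemma degree_addc m1 m2 x : degree (addc m1 m2) x = (degree m1 x + degree m2 x)%N.
Proof. by rewrite !degreeE -big_split; apply: eq_bigr => e _; rewrite ffunE. Qed.

Lemma sources_addc m1 m2 : sources (addc m1 m2) = sdiff (sources m1) (sources m2).
Proof. by apply/setP => x; rewrite !inE degree_addc oddD. Qed.

Lemma linked_addc m1 m2 x y : linked (addc m1 m2) x y = linked m1 x y || linked m2 x y.
Proof.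
by rewrite /linked -addn_gt0 !mult_edgesE -big_split; congr (0 < _)%N; apply: eq_bigr => e _; rewrite ffunE.
Qed.

Definition unitc e : cur := [ffun f => (f == e) : nat].

Definition bumpc e m : cur := addc m (unitc e).

Lemma degree_bumpc e m x : degree (bumpc e m) x = (degree m x + (x \in val e))%N.
Proof.
rewrite degree_addc; congr addn; rewrite degreeE.
under eq_bigr do rewrite ffunE.
have [xe|xe] := boolP (x \in val e).
  rewrite (bigD1 e) //= eqxx big1 // => f /andP[_ /negPf ->] //.
by rewrite big1 // => f xf; case: eqP => // fe; rewrite fe (negPf xe) in xf.
Qed.

Lemma sources_bumpc e m : sources (bumpc e m) = sdiff (sources m) (val e).
Proof. by apply/setP => x; rewrite !inE degree_bumpc oddD oddb. Qed.

Lemma sdiffK (A B : {set V}) : sdiff (sdiff A B) B = A.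
Proof. by apply/setP => x; rewrite !inE addbK. Qed.

Lemma sdiffC (A B : {set V}) : sdiff A B = sdiff B A.
Proof. by apply/setP => x; rewrite !inE addbC. Qed.

Lemma sdiff_disjoint (A B : {set V}) : [disjoint A & B] -> sdiff A B = A :|: B.
Proof.
move=> dAB; apply/setP => x; rewrite !inE.
by case xA: (x \in A) => //=; rewrite (disjointFr dAB).
Qed.

(** * Weights and the removal of one unit of current *)

Section Weight.
Context {R : realType}.
Variable d : R.
Hypothesis d_ge0 : 0 <= d.

Definition wgt m : R := \prod_e (d ^+ m e / (m e)`!%:R).

Lemma wgt_ge0 m : 0 <= wgt m.
Proof. by apply: prodr_ge0 => e _; rewrite divr_ge0 ?exprn_ge0. Qed.

Lemma wgt_bumpc e m : wgt (bumpc e m) * (m e).+1%:R = d * wgt m.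
Proof.
rewrite /wgt (bigD1 e) //= [in RHS](bigD1 e) //= !ffunE eqxx addn1 factS natrM.
rewrite [in LHS](eq_bigr (fun f => d ^+ m f / (m f)`!%:R)); last first.
  by move=> f /negPf fe; rewrite !ffunE fe addn0.
set P := \prod_(_ | _) _.
have m1 : (m e).+1%:R != 0 :> R by rewrite pnatr_eq0.
have m2 : (m e)`!%:R != 0 :> R by rewrite pnatr_eq0 -lt0n fact_gt0.
rewrite exprS; move: m1 m2 P; move: (_.+1%:R) (_`!%:R) (d ^+ m e) => u v D m1 m2 P.
by field; rewrite m1 m2.
Qed.

(** This is k / k! = 1 / (k - 1)!: the factor [m e] kills the currents vanishing on [e], and every
    other current is [bumpc e] of a unique one, at the cost of a factor [d]. *)
Lemma mass_shift e (G : cur -> R) : (forall m, 0 <= G m) ->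
  mass (fun m => wgt m * (m e)%:R * G m) =
  (d%:E * mass (fun m => (wgt m * G (bumpc e m))%R))%E.
Proof.
move=> G0; rewrite -massZ //; last by move=> m; rewrite mulr_ge0 ?wgt_ge0.
pose P : set cur := [set m : cur | (0 < m e)%N]%classic.
transitivity (\esum_(m in P) (wgt m * (m e)%:R * G m)%:E)%classic%E.
  rewrite /mass [RHS]esum_mkcond; apply: eq_esum => m _.
  case: ifPn => //; rewrite notin_setE /P /= => /negP; rewrite -eqn0Ngt => /eqP ->.
  by rewrite mulr0 mul0r.
rewrite (@reindex_esum _ _ _ classical_sets.setT P (bumpc e)).
  by apply: eq_esum => m _; rewrite !ffunE eqxx addn1 wgt_bumpc mulrA.
split.
- by move=> m _; rewrite /P /= !ffunE eqxx addn1.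
- move=> m1 m2 _ _ /ffunP h; apply/ffunP => f; move: (h f).
  by rewrite !ffunE; apply: addIn.
- move=> m /= me; exists [ffun f => (m f - (f == e))%N] => //.
  apply/ffunP => f; rewrite !ffunE subnK //.
  by case: eqP => [->|].
Qed.

End Weight.
End Currents.

(** * Partition functions *)

Lemma sum_exp_coeff_le (R : realType) (x : R) N : 0 <= x ->
  \sum_(i < N) x ^+ i / i`!%:R <= expR x.
Proof.
move=> x0; rewrite -(big_mkord xpredT (fun i => x ^+ i / i`!%:R)).
apply: (@nondecreasing_cvgn_le R (series (exp_coeff x)) _ _ N); last exact: is_cvg_series_exp_coeff.
by apply: nondecreasing_series => i _ _; rewrite /exp_coeff /= divr_ge0 ?exprn_ge0.
Qed.

Section PartitionFunction.
Variable V : finType.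
Notation E := (pairs V).
Notation cur := (current E).
Implicit Types (m : cur) (e : edge E).
Context {R : realType}.
Variable d : R.
Hypothesis d_ge0 : 0 <= d.

(** A finite family of currents lies in a box of bounded multiplicities. The sum over the box
    factorizes over the edges into truncated exponential series. *)
Lemma mass_wgt_le : (mass (@wgt V R d) <= (\prod_(e : edge E) expR d)%:E)%E.
Proof.
apply: ge_ereal_sup => _ [A [finA _] <-].
have [r Ar] : exists r : seq cur, A = [set` r]%classic by apply/finite_seqP.
pose N := (\max_(m <- r) \max_(e : edge E) m e)%N.
pose emb (f : {ffun edge E -> 'I_N.+1}) : cur := [ffun e => f e : nat].
have inj_emb : injective emb.
  by move=> f g /ffunP h; apply/ffunP => e; apply: val_inj; have := h e; rewrite !ffunE.
pose B := [set emb f | f in [set: {ffun edge E -> 'I_N.+1}]]%classic.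
have finB : finite_set B by apply: finite_image; exact: finite_finset.
have AB : {subset A <= B}.
  move=> m /set_mem mA; apply: mem_set; rewrite /B /=.
  exists [ffun e => inord (m e)] => //; apply/ffunP => e; rewrite !ffunE inordK //.
  have mr : m \in r by rewrite Ar in mA.
  rewrite ltnS /N (big_rem m) //=; apply: leq_trans (leq_maxl _ _).
  exact: (leq_bigmax e).
apply: le_trans (lee_fsum_nneg_subset finA finB AB _) _.
  by move=> m _; rewrite lee_fin wgt_ge0.
rewrite fsbig_image; last by move=> f g _ _; apply: inj_emb.
rewrite (@fsbigE _ _ _ _ _ (index_enum {ffun edge E -> 'I_N.+1})) ?index_enum_uniq //; last first.
  by move=> f _; rewrite mem_index_enum.
rewrite (eq_bigl xpredT) => [|f]; last by rewrite classical_sets.in_setT.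
rewrite sumEFin lee_fin.
apply: le_trans (_ : \prod_(e : edge E) \sum_(i < N.+1) d ^+ i / i`!%:R <= _).
  rewrite bigA_distr_bigA /=; apply: ler_sum => f _; rewrite /wgt.
  by apply: ler_prod => e _; rewrite ffunE lexx andbT divr_ge0 ?exprn_ge0.
apply: ler_prod => e _; rewrite sum_exp_coeff_le // andbT.
by apply: sumr_ge0 => i _; rewrite divr_ge0 ?exprn_ge0.
Qed.

Lemma fin_mass_wgt (G : cur -> R) : (forall m, 0 <= G m <= 1) ->
  mass (fun m => wgt d m * G m) \is a fin_num.
Proof.
move=> G01; rewrite ge0_fin_numE; last first.
  by apply: mass_ge0 => m; have /andP[? _] := G01 m; rewrite mulr_ge0 ?wgt_ge0.
apply: le_lt_trans (ltry (\prod_(e : edge E) expR d)).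
apply: le_trans mass_wgt_le; apply: le_mass => m.
by have /andP[? ?] := G01 m; rewrite ler_piMr ?wgt_ge0.
Qed.

Definition pf (S : {set V}) : R :=
  fine (mass (fun m => wgt d m * (sources m == S)%:R)).

Lemma boolr01 (b : bool) : 0 <= (b%:R : R) <= 1.
Proof. by case: b; rewrite ?lexx ler01. Qed.

Lemma pfE S : mass (fun m => wgt d m * (sources m == S)%:R) = (pf S)%:E.
Proof. by rewrite /pf fineK // fin_mass_wgt // => m; apply: boolr01. Qed.

Lemma pf_ge0 S : 0 <= pf S.
Proof. by apply: fine_ge0; apply: mass_ge0 => m; rewrite mulr_ge0 ?wgt_ge0. Qed.

Lemma pf_odd (S : {set V}) : odd #|S| -> pf S = 0.
Proof.
move=> oS; rewrite /pf (@eq_mass _ _ _ (fun=> 0)) ?mass_const0 // => m.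
by case: eqP => [h|_]; rewrite ?mulr0 //; have := even_card_sources m; rewrite h oS.
Qed.

Lemma pf_set0_gt0 : 0 < pf set0.
Proof.
rewrite -lte_fin -pfE; pose m0 : cur := [ffun=> 0%N].
have s0 : sources m0 = set0.
  by apply/setP => x; rewrite in_sources degreeE inE big1 // => e _; rewrite ffunE.
apply: lt_le_trans (_ : ((1 : R)%:E <= _)%E); first by rewrite lte_fin ltr01.
apply: esum_ge; exists [set m0]%classic; first by split.
rewrite fsbig_set1 lee_fin s0 eqxx mulr1 /wgt big1 // => e _.
by rewrite ffunE expr0 divr1.
Qed.

Lemma mass_degree x (G : cur -> R) : (forall m, 0 <= G m) ->
  mass (fun m => wgt d m * (degree m x)%:R * G m) =
  (\sum_(e : edge E | x \in val e) d%:E * mass (fun m => (wgt d m * G (bumpc e m))%R))%E.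
Proof.
move=> G0; under [RHS]eq_bigr do rewrite -mass_shift //.
rewrite -mass_sum; last by move=> e m; rewrite !mulr_ge0 ?wgt_ge0.
by apply: eq_mass => m; rewrite -mulr_suml -mulr_sumr -natr_sum degreeE.
Qed.

Lemma sdiff_eq (A B C : {set V}) : (sdiff A B == C) = (A == sdiff C B).
Proof. by apply/eqP/eqP => [<-|->]; rewrite sdiffK. Qed.

(** Taking one unit off the edge from [x] to [y] toggles both ends in the source set. *)
Lemma mass_degree1 x S :
  mass (fun m => wgt d m * (degree m x)%:R * (sources m == S)%:R) =
  (d * \sum_(y | y != x) pf (sdiff S [set x; y]))%:E.
Proof.
rewrite mass_degree // -(sum_edges_at (V := V) x (fun e : {set V} => pf (sdiff S e))) mulr_sumr -sumEFin.
apply: eq_bigr => e _; rewrite EFinM -pfE; congr (_ * _)%E; apply: eq_mass => m.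
by rewrite sources_bumpc sdiff_eq.
Qed.

(** A second factorial moment. In [mass_degree] the current gains an edge at [x], so the predecessor
    of its degree is the old degree and [mass_degree1] applies again. *)
Lemma mass_degree2 x S :
  mass (fun m => wgt d m * (degree m x)%:R * ((degree m x).-1%:R * (sources m == S)%:R)) =
  (d * \sum_(z | z != x) (d * \sum_(y | y != x) pf (sdiff (sdiff S [set x; z]) [set x; y])))%:E.
Proof.
rewrite mass_degree; last by move=> m; rewrite mulr_ge0.
rewrite -(sum_edges_at (V := V) x
  (fun e : {set V} => d * \sum_(y | y != x) pf (sdiff (sdiff S e) [set x; y]))) mulr_sumr -sumEFin.
apply: eq_bigr => e xe; rewrite EFinM -mass_degree1; congr (_ * _)%E; apply: eq_mass => m.
by rewrite sources_bumpc sdiff_eq degree_bumpc xe addn1 mulrA.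
Qed.

End PartitionFunction.

(** * Relabelling of the vertices *)

Lemma connect_homo (T1 T2 : finType) (e1 : rel T1) (e2 : rel T2) (f : T1 -> T2) :
  {homo f : x y / e1 x y >-> e2 x y} ->
  {homo f : x y / connect e1 x y >-> connect e2 x y}.
Proof.
move=> hf x y /connectP[p]; elim: p x => [|z p IH] x /=; first by move=> _ ->.
move=> /andP[xz zp] yE; apply: connect_trans (connect1 (hf _ _ xz)) _.
exact: IH.
Qed.

Section Relabel.
Variable V : finType.
Notation E := (pairs V).
Notation cur := (current E).
Implicit Types (m : cur) (e : edge E) (s : {perm V}).

Lemma edge_image_subproof s e : s @: val e \in E.
Proof. by rewrite inE card_imset ?card_edge //; apply: perm_inj. Qed.

Definition edge_image s e : edge E := Sub (s @: val e) (edge_image_subproof s e).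

Lemma edge_imageK s : cancel (edge_image s) (edge_image s^-1).
Proof.
move=> e; apply: val_inj; rewrite /= -imset_comp -[RHS]imset_id.
by apply: eq_imset => x /=; rewrite permK.
Qed.

Lemma edge_image_bij s : bijective (edge_image s).
Proof.
exists (edge_image s^-1); first exact: edge_imageK.
by move=> e; rewrite -[X in edge_image X _](invgK s) edge_imageK.
Qed.

(** A pull-back: sources and clusters of [relabel s m] are the preimages under [s] of those of
    [m]. *)
Definition relabel s m : cur := [ffun e => m (edge_image s e)].

Lemma relabel_bij s : bijective (relabel s).
Proof.
have K t : cancel (relabel t) (relabel t^-1).
  move=> m; apply/ffunP => e; rewrite !ffunE; congr (m _).
  by rewrite -[X in edge_image X _](invgK t) edge_imageK.
by exists (relabel s^-1) => // m; rewrite -[X in relabel X _](invgK s) K.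
Qed.

Lemma mult_relabel s m x y : mult (relabel s m) x y = mult m (s x) (s y).
Proof.
rewrite !mult_edgesE [RHS](reindex (edge_image s)) /=; last first.
  by apply: onW_bij; exact: edge_image_bij.
apply: eq_big => [e|e _]; last by rewrite ffunE.
by rewrite -(inj_eq (imset_inj (@perm_inj _ s))) imsetU1 imset_set1.
Qed.

Lemma degree_relabel s m x : degree (relabel s m) x = degree m (s x).
Proof.
rewrite /degree [RHS](reindex s) /=; last by apply: onW_bij; exists (s^-1)%g; [exact: permK|exact: permKV].
by apply: eq_bigr => y _; rewrite mult_relabel.
Qed.

Lemma sources_relabel s m : s @: sources (relabel s m) = sources m.
Proof.
apply/setP => x; rewrite -[x](permKV s) mem_imset; last exact: perm_inj.
by rewrite !in_sources degree_relabel.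
Qed.

Lemma connect_relabel s m x y :
  connect (linked (relabel s m)) x y = connect (linked m) (s x) (s y).
Proof.
apply/idP/idP; first by apply: connect_homo => {x y} x y; rewrite /linked mult_relabel.
move=> h; rewrite -[x](permK s) -[y](permK s); move: h.
by apply: connect_homo => {x y} x y; rewrite /linked mult_relabel !permKV.
Qed.

Lemma cluster_partition_relabel s m (S : {set V}) :
  [set s @: P | P : {set V} in cluster_partition (relabel s m) S] =
  cluster_partition m (s @: S).
Proof.
rewrite /cluster_partition /equivalence_partition -!imset_comp.
apply: eq_imset => x /=; apply/setP => y; rewrite -[y](permKV s).
rewrite mem_imset; last exact: perm_inj.
by rewrite !inE connect_relabel mem_imset //; exact: perm_inj.
Qed.

Lemma wgt_relabel (R : realType) (d : R) s m : wgt d (relabel s m) = wgt d m.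
Proof.
rewrite /wgt [RHS](reindex (edge_image s)) /=; last by apply: onW_bij; exact: edge_image_bij.
by apply: eq_bigr => e _; rewrite ffunE.
Qed.

Lemma pf_perm (R : realType) (d : R) s (S : {set V}) : pf d (s @: S) = pf d S.
Proof.
rewrite /pf [in RHS](mass_reindex _ (relabel_bij s)); congr fine; apply: eq_mass => m /=.
by rewrite wgt_relabel -(inj_eq (imset_inj (@perm_inj _ s)) (sources (relabel s m))) sources_relabel.
Qed.

(** Induction on the size of [S :\: S']: exchanging a point of [S :\: S'] with a point of [S' :\: S]
    makes it smaller. *)
Lemma card_eq_perm (S S' : {set V}) : #|S| = #|S'| -> exists s : {perm V}, s @: S = S'.
Proof.
have [k] := ubnP #|S :\: S'|; elim: k S => // k IH S.
rewrite ltnS => Sk cS.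
have [D0|[x xD]] := set_0Vmem (S :\: S').
  exists 1%g; rewrite (eq_imset _ (@perm1 V)) imset_id.
  by apply/eqP; rewrite eqEcard -setD_eq0 D0 eqxx cS leqnn.
have cD : #|S :\: S'| = #|S' :\: S| by rewrite !cardsD cS setIC.
have [y yD] : exists y, y \in S' :\: S.
  by apply/set0Pn; rewrite -card_gt0 -cD card_gt0; apply/set0Pn; exists x.
move: xD yD; rewrite !inE => /andP[xS' xS] /andP[yS yS'].
have [||s hs] := IH (tperm x y @: S).
- apply: leq_trans Sk; apply: proper_card; apply/properP; split.
    apply/subsetP => z; rewrite -[z](tpermK x y) inE mem_imset; last exact: perm_inj.
    rewrite !inE; case: tpermP => [->|->|_ _] //; rewrite ?(negPf yS) ?xS ?yS' ?andbF //.
  exists x; first by rewrite inE xS xS'.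
  by rewrite inE -[x in x \in _ @: _](tpermR x y) mem_imset ?(negPf yS) ?andbF //; exact: perm_inj.
- by rewrite card_imset //; exact: perm_inj.
by exists (tperm x y * s)%g; rewrite -hs -imset_comp; apply: eq_imset => z /=; rewrite permM.
Qed.

Lemma pf_card (R : realType) (d : R) (S S' : {set V}) : #|S| = #|S'| -> pf d S = pf d S'.
Proof. by move=> /card_eq_perm[s <-]; rewrite pf_perm. Qed.

End Relabel.

(** * Recurrence for the partition functions *)

Lemma card_sdiff (T : finType) (A B : {set T}) :
  (#|sdiff A B| + #|A :&: B|.*2 = #|A| + #|B|)%N.
Proof.
have c (D : {set T}) : #|D| = (\sum_x (x \in D))%N.
  by rewrite -sum1_card big_mkcond.
rewrite !c -mul2n big_distrr /= -!big_split; apply: eq_bigr => x _ /=.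
by rewrite !inE; case: (x \in A) (x \in B) => [] [].
Qed.

Lemma card_sdiff2 (T : finType) (A : {set T}) x y : y != x ->
  (#|sdiff A [set x; y]| + (x \in A).*2 + (y \in A).*2 = #|A| + 2)%N.
Proof.
move=> yx; have <- : #|[set x; y]| = 2%N by rewrite cards2 eq_sym yx.
rewrite -card_sdiff -addnA -doubleD; congr (_ + _.*2)%N.
have -> : A :&: [set x; y] = [set z in [:: x; y] | z \in A].
  by apply/setP => z; rewrite !inE andbC.
rewrite -sum1_card big_mkcond (bigD1 x) //= (bigD1 y) //= big1.
  by rewrite !inE !eqxx orbT /=; case: (x \in A) (y \in A) => [] [].
by move=> z /andP[zx zy]; rewrite !inE (negPf zx) (negPf zy).
Qed.

Lemma exists_set_card (T : finType) j : (j <= #|T|)%N -> exists A : {set T}, #|A| = j.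
Proof.
move=> jn; exists [set x in take j (enum T)]; rewrite cardsE.
rewrite (card_uniqP _) ?take_uniq ?enum_uniq // size_take -cardE.
by case: ltngtP jn.
Qed.

Section Recurrence.
Variable V : finType.
Context {R : realType}.
Variable d : R.
Hypothesis d_ge0 : 0 <= d.
Let n := #|V|.

(** The number Z_j: by relabelling, [pf] depends only on the number of sources. The value is 0 when
    there are not enough vertices, which agrees with the recurrences. *)
Definition pfn (j : nat) : R := if [pick A : {set V} | #|A| == j] is Some A then pf d A else 0.

Lemma pf_pfn (S : {set V}) : pf d S = pfn #|S|.
Proof.
rewrite /pfn; case: pickP => [S' /eqP cS|/(_ S)]; last by rewrite eqxx.
exact: pf_card.
Qed.

Lemma pfn_ge0 j : 0 <= pfn j.
Proof. by rewrite /pfn; case: pickP => // S _; exact: pf_ge0. Qed.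

Lemma pfn_odd j : odd j -> pfn j = 0.
Proof. by rewrite /pfn; case: pickP => // S /eqP <-; apply: pf_odd. Qed.

Lemma pfn_large j : (n < j)%N -> pfn j = 0.
Proof.
by rewrite /pfn; case: pickP => // S /eqP <-; rewrite ltnNge max_card.
Qed.

(** The neighbours of [x] are counted inside and outside [S]; the subtracted booleans remove [x]
    from the side on which it lies. *)
Lemma sum_over_neighbors (S : {set V}) x (a b : R) (F : V -> R) :
  (forall y, y != x -> y \in S -> F y = a) ->
  (forall y, y != x -> y \notin S -> F y = b) ->
  \sum_(y | y != x) F y =
  (#|S| - (x \in S))%:R * a + (n - #|S| - (x \notin S))%:R * b.
Proof.
move=> Fa Fb; rewrite (bigID (mem S)) /=; congr (_ + _).
  rewrite (eq_bigr (fun=> a)) => [|y /andP[]]; last exact: Fa.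
  rewrite sumr_const -[LHS]mulr_natl; congr (_%:R * _).
  have -> : #|S| = ((x \in S) + #|S :\ x|)%N by rewrite -cardsD1.
  by rewrite addKn; apply: eq_card => y; rewrite !inE.
rewrite (eq_bigr (fun=> b)) => [|y /andP[]]; last exact: Fb.
rewrite sumr_const -[LHS]mulr_natl; congr (_%:R * _).
have -> : (n - #|S| = (x \notin S) + #|~: S :\ x|)%N.
  by rewrite -in_setC -cardsD1 /n -(cardsC S) addKn.
by rewrite addKn; apply: eq_card => y; rewrite !inE.
Qed.

(** Toggling removes the source [x]; the other end is either removed as well, leaving [j] sources,
    or becomes a source, leaving [j.+2]. *)
Lemma sum_pf_in (S : {set V}) x j : x \in S -> #|S| = j.+2 ->
  \sum_(y | y != x) pf d (sdiff S [set x; y]) =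
  j.+1%:R * pfn j + (n - j.+2)%:R * pfn j.+2.
Proof.
move=> xS cS; rewrite (sum_over_neighbors (S := S) (a := pfn j) (b := pfn j.+2)).
- by rewrite xS cS subn0 subn1.
- move=> y yx yS; rewrite pf_pfn; congr pfn.
  by have := card_sdiff2 S yx; rewrite xS yS cS; lia.
- move=> y yx /negPf yS; rewrite pf_pfn; congr pfn.
  by have := card_sdiff2 S yx; rewrite xS yS cS; lia.
Qed.

Lemma sum_pf_out (S : {set V}) x j : x \notin S -> #|S| = j ->
  \sum_(y | y != x) pf d (sdiff S [set x; y]) =
  j%:R * pfn j + (n - j.+1)%:R * pfn j.+2.
Proof.
move=> xS cS; rewrite (sum_over_neighbors (S := S) (a := pfn j) (b := pfn j.+2)).
- by rewrite (negPf xS) cS subn0 -subnDA addn1.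
- move=> y yx yS; rewrite pf_pfn; congr pfn.
  by have := card_sdiff2 S yx; rewrite (negPf xS) yS cS; lia.
- move=> y yx /negPf yS; rewrite pf_pfn; congr pfn.
  by have := card_sdiff2 S yx; rewrite (negPf xS) yS cS; lia.
Qed.

(* A source has odd degree, hence degree at least 1. *)
Lemma pfn_le_mass_degree j : (j.+2 <= n)%N ->
  pfn j.+2 <= d * (j.+1%:R * pfn j + (n - j.+2)%:R * pfn j.+2).
Proof.
move=> jn; have [S cS] := exists_set_card jn.
have [x xS] : exists x, x \in S by apply/set0Pn; rewrite -card_gt0 cS.
rewrite -(sum_pf_in xS cS) -lee_fin -mass_degree1 // -{1}cS -pf_pfn -pfE //.
apply: le_mass => m; case: eqP => [mS|]; rewrite ?mulr0 // !mulr1 ler_peMr ?wgt_ge0 //.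
by rewrite ler1n; move: xS; rewrite -mS in_sources; case: degree.
Qed.

(* For odd degree [D], [D - 1 <= D (D - 1) / 3]. *)
Lemma mass_degree_le_pfn j : (j.+2 <= n)%N ->
  3 * (d * (j.+1%:R * pfn j + (n - j.+2)%:R * pfn j.+2)) <=
  3 * pfn j.+2 +
  d * (d * (j.+1%:R * (j%:R * pfn j + (n - j.+1)%:R * pfn j.+2) +
            (n - j.+2)%:R * (j.+2%:R * pfn j.+2 + (n - j.+3)%:R * pfn j.+4))).
Proof.
move=> jn; have [S cS] := exists_set_card jn.
have [x xS] : exists x, x \in S by apply/set0Pn; rewrite -card_gt0 cS.
have w0 m := @wgt_ge0 V R d d_ge0 m.
have -> : d * (j.+1%:R * (j%:R * pfn j + (n - j.+1)%:R * pfn j.+2) +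
            (n - j.+2)%:R * (j.+2%:R * pfn j.+2 + (n - j.+3)%:R * pfn j.+4)) =
    \sum_(z | z != x) (d * \sum_(y | y != x) pf d (sdiff (sdiff S [set x; z]) [set x; y])).
  rewrite -mulr_sumr; congr (_ * _); apply/esym.
  (* After the first toggle [x] is no longer a source, so [sum_pf_out] handles the second one,
     starting from [j] sources if [z] was in [S] and from [j.+2] otherwise. *)
  have xz z : z != x -> x \notin sdiff S [set x; z] by move=> zx; rewrite !inE xS eqxx.
  rewrite (sum_over_neighbors (S := S) (x := x)
    (a := j%:R * pfn j + (n - j.+1)%:R * pfn j.+2)
    (b := j.+2%:R * pfn j.+2 + (n - j.+3)%:R * pfn j.+4)).
  - by rewrite xS cS subn0 subn1.
  - move=> z zx zS; apply: sum_pf_out; first exact: xz.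
    by have := card_sdiff2 S zx; rewrite xS zS cS; lia.
  - move=> z zx /negPf zS; apply: sum_pf_out; first exact: xz.
    by have := card_sdiff2 S zx; rewrite xS zS cS; lia.
rewrite -(sum_pf_in xS cS) -lee_fin EFinD !(EFinM 3) -mass_degree1 // -mass_degree2 //.
have -> : pfn j.+2 = pf d S by rewrite pf_pfn cS.
rewrite -pfE // -!massZ // -?massD //; do ?by move=> m; rewrite ?mulr_ge0.
apply: le_mass => m; case: eqP => [mS|]; rewrite ?mulr0 ?addr0 // !mulr1.
move: xS; rewrite -mS in_sources; case: (degree m x) => // D /= oD.
(* Here [D] is the degree minus one, hence even: [D = 0] gives equality, and parity excludes
   [D = 1], the only failing value. *)
have D3 : 3 * D.+1%:R <= 3 + D.+1%:R * D%:R :> R.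
  case: D oD => [|[//|D]] _; first by lra.
  rewrite -!natrM -natrD ler_nat; lia.
have := ler_wpM2l (w0 m) D3; lra.
Qed.

End Recurrence.

(** * Two-sided bounds on Z_(j+2) in terms of Z_j *)

Section Gaussian.
Variable V : finType.
Context {R : realType}.
Variables (d lam t : R).
Hypothesis lam_gt0 : 0 < lam.
Hypothesis t_gt0 : 0 < t.
Hypothesis tE : t ^+ 2 = #|V|%:R.
Hypothesis lam_le : lam <= t.
Hypothesis dE : d * t ^+ 2 = 1 - lam / t.
Let n := #|V|.

Let D01 : 0 <= 1 - lam / t <= 1.
Proof.
by rewrite subr_ge0 ler_pdivrMr // mul1r lam_le gerBl divr_ge0 ?ltW.
Qed.

Lemma edge_weight_ge0 : 0 <= d.
Proof.
have t2 : 0 < t ^+ 2 by rewrite exprn_gt0.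
by rewrite -(pmulr_lge0 _ t2) dE; case/andP: D01.
Qed.
Let d_ge0 := edge_weight_ge0.

(** In [pfn_le_mass_degree] the term in Z_(j+2) on the right has coefficient at most
    [d * t ^+ 2 = 1 - lam / t]. Absorbing it on the left leaves [lam / t] times Z_(j+2), and
    multiplication by [t ^+ 2] concludes since [d * t ^+ 2 <= 1]. *)
Lemma pfn_upper j : pfn V d j.+2 * (lam * t) <= j.+1%:R * pfn V d j.
Proof.
have z0 := pfn_ge0 V d_ge0 j; have z2 := pfn_ge0 V d_ge0 j.+2.
have [jn|nj] := leqP j.+2 n; last by rewrite (pfn_large _ nj) mul0r mulr_ge0.
have := pfn_le_mass_degree d_ge0 jn; rewrite -/n.
move: (pfn V d j) (pfn V d j.+2) z0 z2 => z z' z0 z0' h.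
have N : (n - j.+2)%:R <= t ^+ 2 by rewrite tE ler_nat leq_subr.
have h1 : z' <= d * (j.+1%:R * z) + d * t ^+ 2 * z'.
  apply: le_trans h _; rewrite mulrDr lerD2l -mulrA ler_wpM2l // ler_wpM2r //.
have h2 : lam / t * z' <= d * (j.+1%:R * z) by rewrite dE in h1; lra.
have t2 : 0 <= t ^+ 2 by rewrite exprn_ge0 // ltW.
have -> : z' * (lam * t) = t ^+ 2 * (lam / t * z').
  by field; rewrite gt_eqF.
apply: le_trans (ler_wpM2l t2 h2) _.
have -> : t ^+ 2 * (d * (j.+1%:R * z)) = d * t ^+ 2 * (j.+1%:R * z) by ring.
rewrite dE ler_piMl ?mulr_ge0 //; by case/andP: D01.
Qed.

(** Multiply [mass_degree_le_pfn] by [t ^+ 2]. The terms of order [t ^+ 2] in Z_(j+2) cancel up to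
    [3 * lam * t], because [1 - d * t ^+ 2 = lam / t]. The size conditions make each remaining term
    a fraction of order [eta] of the main ones. *)
Lemma pfn_lower (eta : R) j : 0 < eta <= 1 -> lam <= eta * t ->
  j%:R <= 3 * eta * t ^+ 2 -> 5 * j%:R + 9 <= 3 * eta * lam * t ->
  j%:R + 3 <= 3 * eta * lam ^+ 2 -> (j.+2 <= n)%N ->
  (1 - 4 * eta) * (j.+1%:R * pfn V d j) <= lam * t * pfn V d j.+2.
Proof.
move=> /andP[eta0 eta1] H1 H2 H3 H4 jn.
have z0 := pfn_ge0 V d_ge0 j; have z2 := pfn_ge0 V d_ge0 j.+2.
have z4 := pfn_ge0 V d_ge0 j.+4.
have := mass_degree_le_pfn d_ge0 jn; have := pfn_upper j.+2; rewrite -/n.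
have eN1 : (n - j.+2)%:R = t ^+ 2 - (j%:R + 2) :> R.
  by rewrite natrB // tE -addn2 natrD.
have eN2 : (n - j.+1)%:R = t ^+ 2 - (j%:R + 1) :> R.
  by rewrite natrB 1?ltnW // tE -addn1 natrD.
have lN3 : (n - j.+3)%:R <= t ^+ 2 :> R by rewrite tE ler_nat leq_subr.
have N1_ge0 : 0 <= t ^+ 2 - (j%:R + 2) by rewrite -eN1.
have N2_ge0 : 0 <= t ^+ 2 - (j%:R + 1) by rewrite -eN2.
have N3_ge0 : 0 <= (n - j.+3)%:R :> R by [].
have -> : j.+3%:R = j%:R + 3 :> R by rewrite -addn3 natrD.
have -> : j.+2%:R = j%:R + 2 :> R by rewrite -addn2 natrD.
have -> : j.+1%:R = j%:R + 1 :> R by rewrite -addn1 natrD.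
have J0 : 0 <= j%:R :> R by [].
rewrite eN1 eN2.
move: (pfn V d j) (pfn V d j.+2) (pfn V d j.+4) ((n - j.+3)%:R : R) (j%:R : R)
  z0 z2 z4 lN3 N3_ge0 N1_ge0 N2_ge0 J0 H2 H3 H4 => {eN1 eN2 jn j}
  z z' z'' N3 j z0 z2 z4 lN3 N3_ge0 N1_ge0 N2_ge0 J0 H2 H3 H4 U L.
have t2 : 0 < t ^+ 2 by rewrite exprn_gt0.
set N1 := t ^+ 2 - (j + 2) in N1_ge0 L.
set N2 := t ^+ 2 - (j + 1) in N2_ge0 L.
have t2' := ltW t2.
have J1 : 0 <= j + 1 by lra.
have J2 : 0 <= j + 2 by lra.
have D0 : 0 <= d * t ^+ 2 by rewrite dE; case/andP: D01.
have D1 : d * t ^+ 2 <= 1 by rewrite dE; case/andP: D01.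
have Deta : 1 - eta <= d * t ^+ 2.
  by rewrite dE lerB // ler_pdivrMr.
have dN1 : d * N1 <= 1 by apply: le_trans D1; rewrite ler_wpM2l // /N1; lra.
have dN2 : d * N2 <= 1 by apply: le_trans D1; rewrite ler_wpM2l // /N2; lra.
have dN3 : d * N3 <= 1 by apply: le_trans D1; rewrite ler_wpM2l.
have dN10 : 0 <= d * N1 by rewrite mulr_ge0.
have dN20 : 0 <= d * N2 by rewrite mulr_ge0.
have dN30 : 0 <= d * N3 by rewrite mulr_ge0.
have dj : d * j <= 3 * eta.
  rewrite -(ler_pM2r t2); apply: le_trans (_ : (d * t ^+ 2) * j <= _).
    by rewrite le_eqVlt; apply/orP; left; apply/eqP; ring.
  by apply: le_trans H2; rewrite ler_piMl.
have L2 := ler_wpM2l (ltW t2) L.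
(* [b1] to [b5] bound the terms of [L2] *)
have b1 : t ^+ 2 * (d * (d * ((j + 1) * (j * z)))) <= d * t ^+ 2 * ((j + 1) * z) * (3 * eta).
  have -> : t ^+ 2 * (d * (d * ((j + 1) * (j * z)))) = d * t ^+ 2 * ((j + 1) * z) * (d * j) by ring.
  by apply: ler_wpM2l dj; apply: mulr_ge0 => //; apply: mulr_ge0.
have b2 : t ^+ 2 * (d * (d * ((j + 1) * (N2 * z')))) <= (j + 1) * z'.
  have -> : t ^+ 2 * (d * (d * ((j + 1) * (N2 * z')))) = d * t ^+ 2 * (d * N2) * ((j + 1) * z') by ring.
  by apply: ler_piMl; [exact: mulr_ge0|exact: mulr_ile1].
have b3 : t ^+ 2 * (d * (d * (N1 * ((j + 2) * z')))) <= (j + 2) * z'.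
  have -> : t ^+ 2 * (d * (d * (N1 * ((j + 2) * z')))) = d * t ^+ 2 * (d * N1) * ((j + 2) * z') by ring.
  by apply: ler_piMl; [exact: mulr_ge0|exact: mulr_ile1].
have b4 : t ^+ 2 * (d * (d * (N1 * (N3 * z'')))) <= 3 * eta * lam * t * z'.
  (* Z_(j+4) is brought back to Z_(j+2) by [pfn_upper]; the resulting factor (j + 3) / lam ^+ 2 is
     small only because [lam] is large. *)
  apply: le_trans (_ : t ^+ 2 * z'' <= _).
    have -> : t ^+ 2 * (d * (d * (N1 * (N3 * z'')))) = (d * N1) * (d * N3) * (t ^+ 2 * z'') by ring.
    by apply: ler_piMl; [exact: mulr_ge0|exact: mulr_ile1].
  rewrite -(ler_pM2r lam_gt0).
  have -> : t ^+ 2 * z'' * lam = t * (z'' * (lam * t)) by ring.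
  have -> : 3 * eta * lam * t * z' * lam = t * (3 * eta * lam ^+ 2 * z') by ring.
  apply: ler_wpM2l; [exact: ltW | apply: le_trans U _].
  by rewrite ler_wpM2r //.
have b5 : 3 * t ^+ 2 * z' - t ^+ 2 * (3 * (d * (N1 * z'))) <= (3 * lam * t + 3 * (j + 2)) * z'.
  have -> : 3 * t ^+ 2 * z' - t ^+ 2 * (3 * (d * (N1 * z'))) =
     (3 * t ^+ 2 - 3 * (d * t ^+ 2) * t ^+ 2 + 3 * (d * t ^+ 2) * (j + 2)) * z' by rewrite /N1; ring.
  rewrite ler_wpM2r // lerD //; last by rewrite ler_wpM2r //; lra.
  rewrite dE le_eqVlt; apply/orP; left; apply/eqP; field; by rewrite gt_eqF.
(* The coefficient adds up [j + 1] from [b2], [j + 2] from [b3] and [3 * (j + 2)] from [b5]. *)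
have b6 : (5 * j + 9) * z' <= 3 * eta * lam * t * z' by rewrite ler_wpM2r.
have key : d * t ^+ 2 * ((j + 1) * z) * (1 - eta) <= lam * t * z' * (1 + 2 * eta).
  move: L2 b1 b2 b3 b4 b5 b6; clear; nra.
have J1z : 0 <= (j + 1) * z by rewrite mulr_ge0.
have key2 : (1 - eta) * ((j + 1) * z) * (1 - eta) <= lam * t * z' * (1 + 2 * eta).
  apply: le_trans key; rewrite ler_wpM2r ?subr_ge0 // ler_wpM2r //.
(* The constant 4 of the statement comes from (1 - 4 eta)(1 + 2 eta) <= (1 - eta)^2. *)
have e0 : 0 < 1 + 2 * eta by lra.
rewrite -(ler_pM2r e0); apply: le_trans key2.
have -> : (1 - 4 * eta) * ((j + 1) * z) * (1 + 2 * eta) = (1 - 2 * eta - 8 * eta ^+ 2) * ((j + 1) * z) by ring.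
have -> : (1 - eta) * ((j + 1) * z) * (1 - eta) = (1 - 2 * eta + eta ^+ 2) * ((j + 1) * z) by ring.
rewrite ler_wpM2r //; have := sqr_ge0 eta; lra.
Qed.

End Gaussian.

(** * Gaussian asymptotics *)

(* The number of pairings of [2 j] points. *)
Definition dfact (j : nat) : nat := (\prod_(i < j) i.*2.+1)%N.

Lemma dfactS j : dfact j.+1 = (j.*2.+1 * dfact j)%N.
Proof. by rewrite /dfact big_ord_recr /= mulnC. Qed.

Lemma dfact_gt0 j : (0 < dfact j)%N.
Proof. by rewrite /dfact prodn_gt0. Qed.

Lemma dfact_fact j : (dfact j * (2 ^ j * j`!))%N = (j.*2)`!.
Proof.
elim: j => [|j IH]; first by rewrite /dfact big_ord0.
rewrite dfactS doubleS !factS -IH expnS.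
rewrite -mul2n; move: (dfact j) (2 ^ j)%N j`! => a b c; ring.
Qed.

(** Both sides follow from [dfact i] = (2i)! / (2^i i!). Summed over [j], the right side gives
    [2 ^ k * dfact k], the identity behind the vanishing for Gaussian moments. *)
Lemma bin_dfact k j : (j <= k)%N ->
  ('C(k.*2, j.*2) * (dfact j * dfact (k - j)))%N = ('C(k, j) * dfact k)%N.
Proof.
move=> jk.
have h1 := bin_fact jk.
have := @bin_fact k.*2 j.*2; rewrite leq_double -doubleB => /(_ jk).
have e2 : (2 ^ k = 2 ^ j * 2 ^ (k - j))%N by rewrite -expnD subnKC.
rewrite -!dfact_fact -h1 e2 => h2.
have P i : (0 < 2 ^ i * i`!)%N by rewrite muln_gt0 expn_gt0 fact_gt0.
apply/eqP; rewrite -(eqn_pmul2r (P j)) -(eqn_pmul2r (P (k - j)%N)); apply/eqP.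
transitivity ('C(k.*2, j.*2) *
       (dfact j * (2 ^ j * j`!) * (dfact (k - j) * (2 ^ (k - j) * (k - j)`!))))%N; first by ring.
rewrite h2; ring.
Qed.

Lemma sum_even (M : nmodType) (F : nat -> M) k : (forall i, odd i -> F i = 0) ->
  \sum_(i < k.*2.+1) F i = \sum_(j < k.+1) F j.*2.
Proof.
move=> F0; elim: k => [|k IH]; first by rewrite !big_ord_recr !big_ord0.
by rewrite doubleS 2!big_ord_recr [RHS]big_ord_recr /= IH F0 ?addr0 //= odd_double.
Qed.

Lemma sum_subsets (T : finType) (M : nmodType) (S : {set T}) (F : nat -> M) :
  \sum_(A : {set T} | A \subset S) F #|A| = \sum_(i < #|S|.+1) F i *+ 'C(#|S|, i).
Proof.
rewrite (partition_big (fun A : {set T} => inord #|A| : 'I_#|S|.+1) xpredT) //=.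
apply: eq_bigr => i _; rewrite -(cards_draws S i) -sumr_const.
apply: eq_big => [A|A].
  rewrite !inE; case AS: (A \subset S) => //=.
  by rewrite -val_eqE /= inordK // ltnS subset_leq_card.
by move=> /andP[AS /eqP <-]; rewrite inordK // ltnS subset_leq_card.
Qed.

(** * Comparison with Gaussian moments *)

Section Iterate.
Variable V : finType.
Context {R : realType}.
Variables (d lam t : R).
Hypothesis lam_gt0 : 0 < lam.
Hypothesis t_gt0 : 0 < t.
Hypothesis tE : t ^+ 2 = #|V|%:R.
Hypothesis lam_le : lam <= t.
Hypothesis dE : d * t ^+ 2 = 1 - lam / t.
Let n := #|V|.
Let L := lam * t.
Let L_gt0 : 0 < L. Proof. exact: mulr_gt0. Qed.
Let d_ge0 : 0 <= d := edge_weight_ge0 lam_gt0 t_gt0 lam_le dE.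
Let z := pfn V d.

Lemma pfn_double_le j : z j.*2 * L ^+ j <= (dfact j)%:R * z 0.
Proof.
elim: j => [|j IH]; first by rewrite /dfact big_ord0 expr0 mulr1 mul1r.
rewrite doubleS dfactS natrM exprS mulrA.
apply: le_trans (_ : j.*2.+1%:R * z j.*2 * L ^+ j <= _).
  by apply: ler_wpM2r; [exact/exprn_ge0/ltW | exact: pfn_upper].
by rewrite -!mulrA ler_wpM2l.
Qed.

Lemma pfn_double_ge (eta : R) k j : 0 < eta -> 4 * eta <= 1 -> lam <= eta * t ->
  k.*2%:R <= 3 * eta * t ^+ 2 -> 5 * k.*2%:R + 9 <= 3 * eta * lam * t ->
  k.*2%:R + 3 <= 3 * eta * lam ^+ 2 -> (k.*2 <= n)%N -> (j <= k)%N ->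
  (1 - 4 * eta) ^+ j * ((dfact j)%:R * z 0) <= z j.*2 * L ^+ j.
Proof.
move=> e0 e1 H1 H2 H3 H4 kn; elim: j => [|j IH] jk.
  by rewrite /dfact big_ord0 !expr0 mulr1 !mul1r.
have jk2 : j.*2%:R <= k.*2%:R :> R by rewrite ler_nat leq_double ltnW.
have := @pfn_lower V R d lam t lam_gt0 t_gt0 tE lam_le dE eta j.*2.
rewrite e0 -/z /= => /(_ _ H1) low.
have {}low : (1 - 4 * eta) * (j.*2.+1%:R * z j.*2) <= lam * t * z j.*2.+2.
  apply: low; [lra|lra|lra|lra|].
  by apply: leq_trans kn; rewrite -doubleS leq_double.
rewrite doubleS dfactS natrM exprS.
have e2 : 0 <= 1 - 4 * eta by lra.
apply: le_trans (_ : (1 - 4 * eta) * j.*2.+1%:R * (z j.*2 * L ^+ j) <= _).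
  apply: le_trans (ler_wpM2l _ (IH (ltnW jk))); last by rewrite mulr_ge0.
  by rewrite le_eqVlt; apply/orP; left; apply/eqP; rewrite -/z; move: (dfact j) => ?; ring.
have -> : (1 - 4 * eta) * j.*2.+1%:R * (z j.*2 * L ^+ j) = (1 - 4 * eta) * (j.*2.+1%:R * z j.*2) * L ^+ j by ring.
have -> : z j.*2.+2 * L ^+ j.+1 = lam * t * z j.*2.+2 * L ^+ j by rewrite exprS /L; ring.
by rewrite ler_wpM2r ?exprn_ge0 // ltW.
Qed.

(** Only subsets of even size 2j contribute. Bounding both factors by Gaussian moments and applying
    [bin_dfact] leaves the sum of the binomials ['C(k, j)], that is [2 ^ k]. *)
Lemma sum_subsets_pf (S : {set V}) k : #|S| = k.*2 ->
  (\sum_(A : {set V} | A \subset S) pf d A * pf d (S :\: A)) * L ^+ k <=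
  (2 ^ k * dfact k)%:R * z 0 ^+ 2.
Proof.
move=> cS.
rewrite (eq_bigr (fun A : {set V} => z #|A| * z (k.*2 - #|A|)%N)); last first.
  by move=> A AS; rewrite !pf_pfn cardsD (setIidPr AS) cS.
rewrite (sum_subsets S (fun i => z i * z (k.*2 - i)%N)) cS.
rewrite (@sum_even _ (fun i => z i * z (k.*2 - i)%N *+ 'C(k.*2, i))); last first.
  by move=> i oi; rewrite /z pfn_odd // mul0r mul0rn.
rewrite mulr_suml natrM natrX.
have -> : (2 : R) ^+ k = \sum_(j < k.+1) ('C(k, j))%:R.
  rewrite -[2]/(1 + 1) exprDn; apply: eq_bigr => i _.
  by rewrite !expr1n mulr1.
rewrite !mulr_suml; apply: ler_sum => j _.
have jk : (j <= k)%N by rewrite -ltnS.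
have LE : L ^+ k = L ^+ j * L ^+ (k - j) by rewrite -exprD subnKC.
rewrite -natrM -bin_dfact // -doubleB LE -mulr_natl !natrM -!mulrA.
rewrite ler_wpM2l //.
have -> : z j.*2 * (z (k - j).*2 * (L ^+ j * L ^+ (k - j))) = (z j.*2 * L ^+ j) * (z (k - j).*2 * L ^+ (k - j)) by ring.
have -> : (dfact j)%:R * ((dfact (k - j))%:R * z 0 ^+ 2) = ((dfact j)%:R * z 0) * ((dfact (k - j))%:R * z 0) by ring.
by apply: ler_pM; rewrite ?pfn_double_le // mulr_ge0 ?pfn_ge0 ?exprn_ge0 // ltW.
Qed.

End Iterate.

(** * Splittings and spins *)

Lemma esum_finType (R : realType) (T : finType) (F : T -> \bar R) :
  (forall x, 0 <= F x)%E -> (\esum_(x in [set: T]) F x)%classic%E = (\sum_x F x)%E.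
Proof.
move=> F0; rewrite esum_fset //; last exact: finite_finset.
rewrite (@fsbigE _ _ _ _ _ (index_enum T)) ?index_enum_uniq //; last first.
  by move=> f _; rewrite mem_index_enum.
by apply: eq_bigl => f; rewrite classical_sets.in_setT.
Qed.

Section Switching.
Variable V : finType.
Notation E := (pairs V).
Notation cur := (current E).
Context {R : realType}.
Implicit Types (m : cur) (e : edge E) (s : {ffun V -> bool}) (S T : {set V}).

Definition max_mult m : nat := (\max_e m e)%N.

(** Bounded currents indexed by a finite type. With a common bound for all edges, some [f] exceed
    [m] somewhere; a vanishing binomial then discards them. *)
Definition box_current N (f : {ffun edge E -> 'I_N}) : cur := [ffun e => f e : nat].

(* The number of ways of splitting the multigraph with edge multiplicities [m]
   into two, the first part having source set [T]. *)
Definition splittings T m : R :=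
  \sum_(f : {ffun edge E -> 'I_(max_mult m).+1} | sources (box_current f) == T)
     \prod_e 'C(m e, f e)%:R.

Definition sgn (b : bool) : R := (-1) ^+ b.

Definition edge_sgn s e : R := \prod_(x in val e) sgn (s x).

Lemma sgn_exp b k : sgn b ^+ k = (-1) ^+ (b && odd k).
Proof. by case: b; rewrite /sgn /= ?expr0 ?expr1n ?expr1 ?signr_odd. Qed.

(** Fourier inversion on spins: the sum factorizes over the vertices, and the factor at [x] is 2 or
    0 according to the parity of the degree plus the indicator of [T]. *)
Lemma source_indicator m T :
  \sum_(s : {ffun V -> bool}) (\prod_(x in T) sgn (s x)) * \prod_e edge_sgn s e ^+ m e =
  2 ^+ #|V| * (sources m == T)%:R.
Proof.
transitivity (\prod_(x : V) \sum_(b : bool) (-1) ^+ (b && (odd (degree m x) (+) (x \in T))) : R).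
  rewrite bigA_distr_bigA /=; apply: eq_bigr => s _.
  have -> : \prod_e edge_sgn s e ^+ m e = \prod_x sgn (s x) ^+ degree m x.
    under eq_bigr do rewrite /edge_sgn -prodrXl big_mkcond.
    rewrite exchange_big; apply: eq_bigr => x _.
    by rewrite -big_mkcond degreeE -prodrXr.
  rewrite [X in X * _]big_mkcond -big_split; apply: eq_bigr => x _ /=.
  rewrite sgn_exp; case: (x \in T); last by rewrite mul1r addbF.
  by rewrite /sgn -signr_addb addbT; case: (s x) => //; case: odd.
have b2 x : \sum_(b : bool) (-1) ^+ (b && (odd (degree m x) (+) (x \in T))) =
    if (x \in sources m) == (x \in T) then 2 else 0 :> R.
  rewrite (bigD1 true) //= (big_pred1 false) => [|b]; last by case: b.
  rewrite in_sources; case: odd (x \in T) => [] [] /=; rewrite ?expr0 ?expr1 ?addNr //.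
rewrite (eq_bigr _ (fun x _ => b2 x)); case: (eqVneq (sources m) T) => [->|/eqP mT].
  by rewrite (eq_bigr (fun=> 2)) => [|x _]; rewrite ?eqxx // prodr_const mulr1 cardT.
have [x xP] : exists x, (x \in sources m) != (x \in T).
  apply/existsP; rewrite -negb_forall; apply/negP => /forallP h.
  by apply: mT; apply/setP => x; apply/eqP.
by rewrite (bigD1 x) //= (negPf xP) mul0r mulr0.
Qed.

Lemma binomial_generating (y : R) k N : (k <= N)%N ->
  \sum_(i < N.+1) 'C(k, i)%:R * y ^+ i = (1 + y) ^+ k.
Proof.
move=> kN; rewrite exprDn (big_ord_widen N.+1 (fun i => 1 ^+ (k - i) * y ^+ i *+ 'C(k, i))) ?ltnS //.
rewrite [RHS]big_mkcond; apply: eq_bigr => i _.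
by rewrite expr1n mul1r mulr_natl ltnS; case: leqP => // /bin_small ->.
Qed.

Definition compatible m : {set {ffun V -> bool}} :=
  [set s : {ffun V -> bool} | [forall x, forall y, linked m x y ==> (s x == s y)]].

Lemma compatibleP m s :
  reflect (forall x y, linked m x y -> s x = s y) (s \in compatible m).
Proof.
rewrite inE; apply: (iffP forallP) => h x.
  by move=> y xy; have /forallP/(_ y)/implyP/(_ xy)/eqP := h x.
by apply/forallP => y; apply/implyP => xy; apply/eqP/h.
Qed.

Lemma compatible_connect m s x y : s \in compatible m -> connect (linked m) x y -> s x = s y.
Proof.
move=> /compatibleP cs /connectP[p]; elim: p x => [|z p IH] x /=; first by move=> _ ->.
by move=> /andP[/cs-> zp] yE; apply: IH.
Qed.

Lemma edge_sgn_pair s e a b : a != b -> val e = [set a; b] ->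
  edge_sgn s e = (-1) ^+ (s a (+) s b).
Proof.
move=> ab eE; rewrite /edge_sgn eE big_setU1 ?inE //= big_set1.
by rewrite /sgn signr_addb.
Qed.

(** Each factor is a power of 2 or of 0, and 0 ^ 0 = 1 makes the edges without current impose no
    condition. *)
Lemma prod_edge_sgn m s :
  \prod_e (1 + edge_sgn s e) ^+ m e = 2 ^+ (\sum_e m e) * (s \in compatible m)%:R.
Proof.
case: (boolP (s \in compatible m)) => [/compatibleP cs|ncs].
  rewrite mulr1 -prodrXr; apply: eq_bigr => e _.
  have [->|me] := posnP (m e); first by rewrite !expr0.
  have /cards2P[a [b [ab eE]]] := introT eqP (card_edge e).
  rewrite (edge_sgn_pair _ ab eE) (cs a b) ?addbb ?expr0 //.
  by apply/linkedP; exists e.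
rewrite mulr0; have [e me se] : exists2 e, (0 < m e)%N & edge_sgn s e = -1.
  move: ncs; rewrite inE negb_forall => /existsP[a]; rewrite negb_forall => /existsP[b].
  rewrite negb_imply => /andP[/linkedP[e eE me] sab]; exists e => //.
  have ab : a != b by apply: contraNneq sab => ->.
  by rewrite (edge_sgn_pair _ ab eE); case: (s a) (s b) sab => [] [].
by rewrite (bigD1 e) //= se subrr expr0n eqn0Ngt me mul0r.
Qed.

(** Insert Fourier inversion and exchange the sums; for fixed spins, the sum over [f] is a product
    of binomial expansions. The set [T] survives only in the product of its spins over
    configurations constant on clusters. *)
Lemma splittingsE T m : 2 ^+ #|V| * splittings T m =
  2 ^+ (\sum_e m e) * \sum_(s in compatible m) \prod_(x in T) sgn (s x).
Proof.
have fourier (f : {ffun edge E -> 'I_(max_mult m).+1}) :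
    (if sources (box_current f) == T then 2 ^+ #|V| * \prod_e 'C(m e, f e)%:R else 0) =
    \sum_(s : {ffun V -> bool}) (\prod_(x in T) sgn (s x)) *
       \prod_e ('C(m e, f e)%:R * edge_sgn s e ^+ f e) :> R.
  transitivity (2 ^+ #|V| * (sources (box_current f) == T)%:R * \prod_e 'C(m e, f e)%:R : R).
    by case: ifP => _; rewrite ?mulr1 ?mulr0 ?mul0r.
  rewrite -source_indicator mulr_suml; apply: eq_bigr => s _.
  rewrite big_split /= [in RHS]mulrCA [RHS]mulrC; congr (_ * _ * _).
  by apply: eq_bigr => e _; rewrite ffunE.
rewrite /splittings [LHS]mulr_sumr [LHS]big_mkcond.
transitivity (\sum_(f : {ffun edge E -> 'I_(max_mult m).+1}) \sum_(s : {ffun V -> bool})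
    (\prod_(x in T) sgn (s x)) * \prod_e ('C(m e, f e)%:R * edge_sgn s e ^+ f e) : R).
  by apply: eq_bigr => f _; exact: fourier.
rewrite exchange_big /= mulr_sumr [RHS]big_mkcond; apply: eq_bigr => s _.
rewrite -mulr_sumr -(bigA_distr_bigA (fun e (i : 'I_(max_mult m).+1) => 'C(m e, i)%:R * edge_sgn s e ^+ i)).
rewrite (eq_bigr (fun e => (1 + edge_sgn s e) ^+ m e)); last first.
  by move=> e _; rewrite binomial_generating // /max_mult; exact: leq_bigmax.
rewrite prod_edge_sgn; case: ifP => _; last by rewrite !mulr0.
by rewrite mulr1 mulrC.
Qed.

Lemma splittings_ge0 T m : 0 <= splittings T m.
Proof. by apply: sumr_ge0 => f _; apply: prodr_ge0. Qed.

Lemma le_splittings_set0 T m : splittings T m <= splittings set0 m.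
Proof.
have p2 k : 0 < 2 ^+ k :> R by rewrite exprn_gt0.
rewrite -(ler_pM2l (p2 #|V|)) !splittingsE ler_pM2l //; apply: ler_sum => s _.
rewrite big_set0; apply: le_trans (ler_norm _) _; rewrite normr_prod.
by rewrite big1 // => x _; rewrite /sgn normrX normrN1 expr1n.
Qed.

Definition trivial_on m S : {set {ffun V -> bool}} :=
  [set s in compatible m | [forall x in S, ~~ s x]].

(** Summing the spin products over all [T] inside [S] gives the product over [S] of [sgn (s x) + 1],
    which is [2 ^+ #|S|] or 0. *)
Lemma sum_splittings S m :
  2 ^+ #|V| * \sum_(T : {set V} | T \subset S) splittings T m =
  2 ^+ (\sum_e m e) * (2 ^+ #|S| * #|trivial_on m S|%:R).
Proof.
rewrite [LHS]mulr_sumr (eq_bigr _ (fun T _ => splittingsE T m)).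
rewrite -[LHS]mulr_sumr exchange_big /=; congr (_ * _).
rewrite -(sum1_card (mem (trivial_on m S))) natr_sum [RHS]mulr_sumr [RHS]big_mkcond [LHS]big_mkcond /=.
apply: eq_bigr => s _; have -> : (s \in trivial_on m S) = (s \in compatible m) && [forall x in S, ~~ s x].
  by rewrite [in LHS]inE.
case: (s \in compatible m) => //=.
transitivity (\prod_(x in S) (sgn (s x) + 1)).
  rewrite [RHS]big_mkcond /= (eq_bigr (fun x => (if x \in S then sgn (s x) else 0) + 1)); last first.
    by move=> x _; case: ifP => // _; rewrite add0r.
  rewrite [RHS]bigA_distr [LHS]big_mkcond; apply: eq_bigr => T _ /=.
  case: ifPn => [/subsetP TS|/subsetPn[x xT xS]].
    by rewrite [LHS]big_mkcond; apply: eq_bigr => x _; case: ifP => // /TS ->.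
  by rewrite (bigD1 x) //= xT (negPf xS) mul0r.
case: ifPn => [/forall_inP s0|].
  rewrite mulr1 (eq_bigr (fun=> 2)) ?prodr_const // => x xS.
  by rewrite /sgn (negPf (s0 x xS)) expr0.
rewrite negb_forall_in => /exists_inP[x xS]; rewrite negbK => sx.
by rewrite (bigD1 x) //= /sgn sx expr1 addNr mul0r.
Qed.

(* A compatible spin configuration is determined up to one which vanishes on [S]
   by its values on the clusters meeting [S]. *)
Lemma card_compatible_le m S :
  (#|compatible m| <= 2 ^ #|cluster_partition m S| * #|trivial_on m S|)%N.
Proof.
set p := cluster_partition m S.
pose r s := [set P in p | [exists x in P, s x]].
rewrite -sum1_card (partition_big r (fun Q => Q \in powerset p)) /=; last first.
  by move=> s _; rewrite powersetE; apply/subsetP => P; rewrite inE => /andP[].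
rewrite -card_powerset -sum_nat_const; apply: leq_sum => Q _.
rewrite sum1dep_card.
have [->|[s0]] := set_0Vmem [set s | (s \in compatible m) && (r s == Q)]; first by rewrite cards0.
rewrite inE => /andP[c0 /eqP r0].
(* Translation by one member [s0] of the fibre of [r] over [Q] injects this fibre into the
   configurations trivial on [S]. *)
pose tr s : {ffun V -> bool} := [ffun x => s x (+) s0 x].
have tr_inj : injective tr.
  by move=> s s' /ffunP h; apply/ffunP => x; have := h x; rewrite !ffunE; apply: addIb.
rewrite -(card_imset _ tr_inj); apply: subset_leq_card; apply/subsetP => s'.
move=> /imsetP[s]; rewrite inE => /andP[cs /eqP rs] ->; rewrite !inE.
apply/andP; split.
  apply/forallP => x; apply/forallP => y; apply/implyP => xy; rewrite !ffunE.
  by rewrite (compatibleP _ _ cs x y xy) (compatibleP _ _ c0 x y xy).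
apply/forall_inP => x xS; rewrite ffunE.
pose P := [set y in S | connect (linked m) x y].
have Pp : P \in p by apply/imsetP; exists x.
have xP : x \in P by rewrite inE xS connect0.
have val_on t : t \in compatible m -> (P \in r t) = t x.
  move=> ct; rewrite inE Pp /=; apply/exists_inP/idP => [[y]|tx]; last by exists x.
  by rewrite inE => /andP[_ /(compatible_connect ct) ->].
by rewrite -(val_on s cs) -(val_on s0 c0) rs r0 addbb.
Qed.

(** Of the factor [2 ^+ (k + c)] given by [sum_splittings], [2 ^+ c] pays for replacing
    [trivial_on m S] by all compatible configurations. *)
Lemma sum_splittings_ge m S k c : #|S| = (k + c)%N -> (#|cluster_partition m S| <= c)%N ->
  2 ^+ k * splittings set0 m <= \sum_(T : {set V} | T \subset S) splittings T m.
Proof.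
move=> cS pc; have p2 i : 0 < 2 ^+ i :> R by rewrite exprn_gt0.
rewrite -(ler_pM2l (p2 #|V|)) sum_splittings mulrCA splittingsE mulrCA ler_pM2l //.
rewrite (eq_bigr (fun=> 1)) => [|s _]; last by rewrite big_set0.
rewrite sumr_const cS exprD -mulrA ler_pM2l // -natrX -natrM ler_nat.
by apply: leq_trans (card_compatible_le m S) _; rewrite leq_mul2r leq_exp2l // pc orbT.
Qed.

End Switching.

(** * Pairs of currents *)

Section DoubleCurrents.
Variable V : finType.
Notation E := (pairs V).
Notation cur := (current E).
Implicit Types (m : cur) (e : edge E) (S T : {set V}).
Context {R : realType}.
Variable d : R.
Hypothesis d_ge0 : 0 <= d.

Let w0 m : 0 <= wgt d m := wgt_ge0 d_ge0 m.

Lemma wgt_split m m1 : (forall e, m1 e <= m e)%N ->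
  wgt d m1 * wgt d ([ffun e => (m e - m1 e)%N] : cur) = wgt d m * \prod_e 'C(m e, m1 e)%:R.
Proof.
move=> le1; rewrite /wgt -!big_split; apply: eq_bigr => e _ /=.
rewrite ffunE -{3}(subnKC (le1 e)) exprD -(bin_fact (le1 e)) !natrM.
have f0 k : k`!%:R != 0 :> R by rewrite pnatr_eq0 -lt0n fact_gt0.
have b0 : 'C(m e, m1 e)%:R != 0 :> R by rewrite pnatr_eq0 -lt0n bin_gt0.
move: (f0 (m1 e)) (f0 (m e - m1 e)%N) b0.
move: ((m1 e)`!%:R) ((m e - m1 e)`!%:R) ('C(_, _)%:R) (d ^+ m1 e) (d ^+ (m e - m1 e)) => a b c x y.
by move=> a0 b0 c0; field; rewrite a0 b0 c0.
Qed.

Definition pair_weight S1 S2 (G : cur -> R) (z : cur * cur) : R :=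
  wgt d z.1 * (sources z.1 == S1)%:R * (wgt d z.2 * (sources z.2 == S2)%:R) *
  G (addc z.1 z.2).

Lemma pair_weight_ge0 S1 S2 (G : cur -> R) z : (forall m, 0 <= G m) ->
  0 <= pair_weight S1 S2 G z.
Proof. by move=> G0; rewrite /pair_weight !mulr_ge0. Qed.

(** Pairs are regrouped by their sum [m] and their first member [m1 <= m]. The product of weights is
    that of [m] times binomials, whose sum over [m1] with sources [S1] is [splittings S1 m]. *)
Lemma mass_switch S1 S2 (G : cur -> R) : (forall m, 0 <= G m) ->
  mass (pair_weight S1 S2 G) =
  mass (fun m => wgt d m * (sources m == sdiff S1 S2)%:R * G m * splittings S1 m).
Proof.
move=> G0; pose J m : set cur := [set m1 : cur | forall e, (m1 e <= m e)%N]%classic.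
pose diff m m1 : cur := [ffun e => (m e - m1 e)%N].
have addK m m1 : J m m1 -> addc m1 (diff m m1) = m.
  by move=> le1; apply/ffunP => e; rewrite !ffunE subnKC.
rewrite {1}/mass (@reindex_esum _ _ _ ([set: cur] `*`` J)%classic _
  (fun z : cur * cur => (z.2, diff z.1 z.2))); last first.
  split => //.
  - move=> [m m1] [m' m1'] /set_mem[/= _ h] /set_mem[/= _ h'] [] e1 e2.
    by rewrite -(addK _ _ h) -(addK _ _ h') e2 e1.
  - move=> [m1 m2] _; exists (addc m1 m2, m1) => /=.
      by split=> //= e; rewrite ffunE leq_addr.
    by congr pair; apply/ffunP => e; rewrite !ffunE addKn.
rewrite -(@esum_esum _ _ _ classical_sets.setT J (fun m m1 => (pair_weight S1 S2 G (m1, diff m m1))%:E)); last first.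
  by move=> m m1 _ _; rewrite lee_fin pair_weight_ge0.
apply: eq_esum => m _.
pose B f := @box_current V (max_mult m).+1 f.
have B_inj : injective B.
  by move=> f f' /ffunP h; apply/ffunP => e; apply: val_inj; have := h e; rewrite !ffunE.
rewrite (@reindex_esum _ _ _ (B @^-1` J m)%classic _ B); last first.
  split => //; first by move=> f f' _ _; apply: B_inj.
  move=> m1 h; have ho e : (m1 e < (max_mult m).+1)%N.
    by rewrite ltnS (leq_trans (h e)) // /max_mult; exact: leq_bigmax.
  have e1 : B [ffun e => Ordinal (ho e)] = m1 by apply/ffunP => e; rewrite !ffunE.
  by exists [ffun e => Ordinal (ho e)]; rewrite //= e1.
rewrite esum_mkcond esum_finType; last first.
  by move=> f; case: ifP => // _; rewrite lee_fin pair_weight_ge0.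
rewrite /splittings mulr_sumr -sumEFin [RHS]big_mkcond; apply: eq_bigr => f _.
case: ifPn => [/set_mem h|].
  rewrite /pair_weight /= addK // -/(B f).
  have -> : sources m = sdiff (sources (B f)) (sources (diff m (B f))).
    by rewrite -sources_addc addK.
  case: (eqVneq (sources (B f)) S1) => [->|_]; last by rewrite mulr0 !mul0r.
  have -> : (sdiff S1 (sources (diff m (B f))) == sdiff S1 S2) = (sources (diff m (B f)) == S2).
    by rewrite ![sdiff S1 _]sdiffC sdiff_eq sdiffK.
  congr EFin; rewrite mulr1.
  have -> : \prod_e 'C(m e, f e)%:R = \prod_e 'C(m e, B f e)%:R :> R.
    by apply: eq_bigr => e _; rewrite ffunE.
  rewrite mulrA wgt_split //; set X := \prod_e _; move: X (G m) (wgt d m) => X g w.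
  by case: eqP => _; ring.
(* Members of the box that are not below [m] have a zero binomial. *)
rewrite notin_setE => nle; case: ifP => // _; congr EFin.
have [e he] : exists e, (m e < B f e)%N.
  by move/existsNP: nle => [e /negP]; rewrite -ltnNge => he; exists e.
by rewrite (bigD1 e) //= bin_small ?mul0r ?mulr0 //; move: he; rewrite ffunE.
Qed.

Lemma mass_pair_weight1 S1 S2 :
  mass (pair_weight S1 S2 (fun=> 1)) = (pf d S1 * pf d S2)%:E.
Proof.
rewrite EFinM -!pfE // -mass_mul.
- by apply: eq_mass => z; rewrite /pair_weight mulr1.
- by move=> m; rewrite mulr_ge0.
- by move=> m; rewrite mulr_ge0.
- by rewrite fin_mass_wgt // => m; exact: boolr01.
Qed.

Definition pair_mass S1 S2 (Q : pred cur) : R :=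
  fine (mass (pair_weight S1 S2 (fun m => (Q m)%:R))).

Lemma pair_massE S1 S2 (Q : pred cur) :
  mass (pair_weight S1 S2 (fun m => (Q m)%:R)) = (pair_mass S1 S2 Q)%:E.
Proof.
rewrite /pair_mass fineK // ge0_fin_numE; last by apply: mass_ge0 => z; exact: pair_weight_ge0.
apply: le_lt_trans (ltry (pf d S1 * pf d S2)); rewrite -mass_pair_weight1.
apply: le_mass => z; rewrite /pair_weight ler_wpM2l ?mulr_ge0 //.
by case: (Q _).
Qed.

Lemma card_even_partition (T : finType) (p : {set {set T}}) (S : {set T}) k :
  finset.partition p S -> (forall P, P \in p -> ~~ odd #|P|) -> #|S| = k.*2 ->
  (#|p| <= k)%N /\ (~~ is_pairing p -> (#|p| < k)%N).
Proof.
move=> pS ev cS; have := card_partition pS; rewrite cS => hk.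
have P2 P : P \in p -> (2 <= #|P|)%N.
  move=> Pp; have := ev P Pp; have : P != set0.
    by apply: contraTneq Pp => ->; case/and3P: pS.
  by rewrite -card_gt0; case: #|P| => [|[]].
have l1 : (#|p| * 2 <= k.*2)%N.
  by rewrite hk -sum_nat_const; apply: leq_sum.
split; first by rewrite -leq_double -muln2.
rewrite negb_forall_in => /exists_inP[P Pp cP].
have l2 : (#|p| * 2 < k.*2)%N.
  rewrite hk -sum_nat_const (bigD1 P) //= [X in (_ < X)%N](bigD1 P) //=.
  rewrite -addSn leq_add //; first by rewrite ltn_neqAle eq_sym cP P2.
  by apply: leq_sum => P' /andP[P'p _]; exact: P2.
by rewrite -ltn_double -muln2.
Qed.

Lemma cluster_partitionP m S : finset.partition (cluster_partition m S) S.
Proof.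
apply: equivalence_partitionP => x y z _ _ _; exact: linked_equiv.
Qed.

(** As the sources of [m'] lie in [S], the block may be replaced by the whole cluster of [m], which
    no edge carrying [m'] leaves. *)
Lemma even_cluster m m' S P :
  (forall x y, linked m' x y -> linked m x y) ->
  P \in cluster_partition m S -> sources m' \subset S -> ~~ odd #|P :&: sources m'|.
Proof.
move=> sub /imsetP[x xS ->] sS.
have -> : [set y in S | connect (linked m) x y] :&: sources m' =
          [set y | connect (linked m) x y] :&: sources m'.
  apply/setP => y; rewrite !in_setI !in_set; case yS: (y \in S) => //=.
  by have := contraFF (subsetP sS y) yS; rewrite inE => ->; rewrite andbF.
apply: odd_sources_closed => y z /sub yz; rewrite !in_set => xy.
exact: connect_trans xy (connect1 yz).
Qed.

(** After [mass_switch] every term is a sum over one multigraph [m] with sources [S1 :|: S2], so the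
    inequality is checked for each [m], according to whether its clusters pair up the sources. The
    product Z_2k Z_0 is read with the empty set first, hence gives [splittings set0]. *)
Lemma nonpairing_bound S1 S2 k : [disjoint S1 & S2] -> #|S1 :|: S2| = k.*2 ->
  2 ^+ k * (pf d (S1 :|: S2) * @pf V R d set0 +
    pair_mass S1 S2 (fun m => ~~ is_pairing (cluster_partition m (S1 :|: S2)))) <=
  \sum_(A : {set V} | A \subset S1 :|: S2) pf d A * pf d ((S1 :|: S2) :\: A).
Proof.
move=> dS cS; set S := S1 :|: S2 in cS *.
have sS : sdiff S1 S2 = S by rewrite sdiff_disjoint.
have s0 : sdiff (set0 : {set V}) S = S by apply/setP => x; rewrite !inE.
have sD (A : {set V}) : A \subset S -> sdiff A (S :\: A) = S.
  move=> AS; apply/setP => x; rewrite inE in_setD.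
  by case xA: (x \in A) => //=; rewrite (subsetP AS).
rewrite -lee_fin EFinM EFinD -pair_massE mulrC -mass_pair_weight1.
have g0 (A : {set V}) (G : cur -> R) : (forall m, 0 <= G m) -> forall m, 0 <= wgt d m * (sources m == S)%:R * G m * splittings A m.
  by move=> G0 m; rewrite !mulr_ge0 ?splittings_ge0.
rewrite !mass_switch // s0 sS -massD; [|exact: g0|exact: g0].
rewrite -massZ; [|by rewrite exprn_ge0|by move=> m; rewrite addr_ge0 // !mulr_ge0 ?splittings_ge0].
rewrite -sumEFin (eq_bigr (fun A : {set V} => mass (fun m => wgt d m * (sources m == S)%:R * 1 * splittings A m))); last first.
  by move=> A AS; rewrite -mass_pair_weight1 mass_switch // sD.
rewrite -mass_sum; last by move=> A; exact: g0.
apply: le_mass => m; rewrite -mulr_sumr; case: eqP => [mS|_]; last first.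
  by rewrite !mulr0 !mul0r addr0 mulr0.
rewrite !mulr1.
have pm := cluster_partitionP m S.
have ev P : P \in cluster_partition m S -> ~~ odd #|P|.
  move=> Pp; have PS : P \subset S.
    by case/and3P: pm => /eqP <- _ _; exact: bigcup_sup.
  have := @even_cluster m m S P (fun _ _ => id) Pp; rewrite mS => /(_ (subxx _)).
  by rewrite (setIidPl PS).
have [ck ck'] := card_even_partition pm ev cS.
set np := is_pairing _ in ck' *; rewrite -[_ * _ * splittings S1 m]mulrA -mulrDr mulrCA ler_wpM2l //.
have sp0 := @splittings_ge0 V R set0 m; have le0 := @le_splittings_set0 V R S1 m.
case: np ck' => /= [_|/(_ isT) ck'].
  by rewrite mul0r addr0; apply: (@sum_splittings_ge V R m S k k) => //; rewrite cS addnn.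
(* With at most [k - 1] clusters, the extra factor 2 covers both [splittings set0 m] and
   [splittings S1 m], the latter being no larger. *)
have := @sum_splittings_ge V R m S k.+1 k.-1.
have k0 : (0 < k)%N by apply: leq_ltn_trans ck'.
rewrite cS addSnnS prednK // addnn => /(_ erefl); rewrite -ltnS prednK // => /(_ ck').
apply: le_trans; rewrite mul1r exprSr -mulrA ler_wpM2l ?exprn_ge0 //; lra.
Qed.

End DoubleCurrents.

(** * Even partitions and pairings *)

Definition map_partition (T T' : finType) (f : T -> T') (p : {set {set T}}) : {set {set T'}} :=
  [set f @: P | P : {set T} in p].

Section MapPartition.
Variables (T T' : finType) (f : T -> T').
Hypothesis f_inj : injective f.

Lemma map_partition_inj : injective (map_partition f).
Proof. exact/imset_inj/imset_inj. Qed.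

Lemma even_partitions_map (S1 S2 : {set T}) (p : {set {set T}}) :
  (map_partition f p \in even_partitions (f @: S1) (f @: S2)) = (p \in even_partitions S1 S2).
Proof.
rewrite !inE -imsetU imset_partition //; congr (_ && _).
apply/forall_inP/forall_inP => h P.
  move=> Pp; have := h (f @: P); rewrite -!imsetI; do ?by move=> ? ? _ _; apply: f_inj.
  by rewrite !card_imset //; apply; apply: imset_f.
case/imsetP=> Q Qp ->; rewrite -!imsetI; do ?by move=> ? ? _ _; apply: f_inj.
by rewrite !card_imset //; apply: h.
Qed.

Lemma is_pairing_map (p : {set {set T}}) : is_pairing (map_partition f p) = is_pairing p.
Proof.
apply/forall_inP/forall_inP => h P; last by case/imsetP=> Q Qp ->; rewrite card_imset //; apply: h.
by move=> Pp; rewrite -(card_imset _ f_inj); apply: h; apply: imset_f.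
Qed.

(** The blocks of [q] lie in the image of [f], so each is the image of its preimage. *)
Lemma map_partition_surj (S1 S2 : {set T}) (q : {set {set T'}}) :
  q \in even_partitions (f @: S1) (f @: S2) ->
  exists2 p, p \in even_partitions S1 S2 & q = map_partition f p.
Proof.
move=> qE; pose p := [set f @^-1: Q | Q : {set T'} in q].
have qp : q = map_partition f p.
  rewrite /map_partition /p -imset_comp -[LHS]imset_id; apply: eq_in_imset => Q Qq /=.
  apply/setP => y; apply/idP/imsetP => [yQ|[x]]; last by rewrite inE => ? ->.
  have : y \in f @: (S1 :|: S2).
    move: qE; rewrite inE -imsetU => /andP[/and3P[/eqP <- _ _] _].
    by apply/bigcupP; exists Q.
  by case/imsetP=> x _ yx; exists x => //; rewrite inE -yx.
by exists p => //; rewrite -even_partitions_map -qp.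
Qed.

End MapPartition.

(** * Passing from one even pairing to another by transpositions *)

Section Pairings.
Variables (T : finType) (S1 S2 : {set T}).

Lemma even_pairing_block (p : {set {set T}}) x y : p \in even_partitions S1 S2 ->
  [set x; y] \in p -> x != y -> (x \in S1) = (y \in S1) /\ (x \in S2) = (y \in S2).
Proof.
rewrite inE => /andP[_ /forall_inP ev] /ev /andP[e1 e2] xy.
have par (S : {set T}) : ~~ odd #|[set x; y] :&: S| -> (x \in S) = (y \in S).
  have -> : #|[set x; y] :&: S| = ((x \in S) + (y \in S))%N.
    rewrite -sum1_card big_mkcond (bigD1 x) //= (bigD1 y) 1?eq_sym //= big1.
      by rewrite !inE !eqxx orbT /=; case: (x \in S) (y \in S) => [] [].
    by move=> z /andP[zx zy]; rewrite !inE (negPf zx) (negPf zy).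
  by rewrite oddD !oddb; case: (x \in S) (y \in S) => [] [].
by split; apply: par.
Qed.

Lemma pairing_blockP (p : {set {set T}}) P x : is_pairing p -> P \in p -> x \in P ->
  exists2 y, y != x & P = [set x; y].
Proof.
move=> /forall_inP pp Pp xP; have cP := eqP (pp P Pp).
have : #|P :\ x| == 1%N.
  by rewrite -(eqn_add2l 1) eq_sym -[(1 + 1)%N]cP [X in X == _](cardsD1 x) xP.
move=> /cards1P[y hy]; exists y; last by rewrite -(setD1K xP) hy.
by have : y \in P :\ x; [rewrite hy set11 | rewrite !inE => /andP[]].
Qed.

Lemma imset_tperm_id x y (P : {set T}) : (x \in P) = (y \in P) -> tperm x y @: P = P.
Proof.
move=> h; apply/setP => z; rewrite -[z](tpermK x y) mem_imset; last exact: perm_inj.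
by rewrite tpermK; case: tpermP => [->|->|].
Qed.

(* A transposition of two points on the same side brings one even pairing closer to another. *)
Lemma pairing_invariant (M : Type) (F : {set {set T}} -> M) :
  (forall x y p, (x \in S1) = (y \in S1) -> (x \in S2) = (y \in S2) ->
     F (map_partition (tperm x y) p) = F p) ->
  forall p p', p \in even_partitions S1 S2 -> is_pairing p ->
    p' \in even_partitions S1 S2 -> is_pairing p' -> F p = F p'.
Proof.
move=> Finv p p' pE pP; have [k] := ubnP #|p :\: p'|; elim: k p' => // k IH p'.
rewrite ltnS => kp p'E p'P.
have pPart := pE; rewrite inE in pPart; have {pPart}/andP[pPart _] := pPart.
have p'Part := p'E; rewrite inE in p'Part; have {p'Part}/andP[p'Part _] := p'Part.
have /and3P[/eqP pcov ptriv p0] := pPart.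
have /and3P[/eqP p'cov p'triv _] := p'Part.
have [D0|[P]] := set_0Vmem (p :\: p').
  congr F; apply/eqP; rewrite eqEcard -setD_eq0 D0 eqxx /=.
  have c2 q : finset.partition q (S1 :|: S2) -> is_pairing q -> #|S1 :|: S2| = (#|q| * 2)%N.
    by move=> qS /forall_inP q2; rewrite (card_partition qS) -sum_nat_const; apply: eq_bigr => Q /q2 /eqP.
  by have := c2 p pPart pP; rewrite (c2 p' p'Part p'P) => /eqP; rewrite eqn_pmul2r // => /eqP ->.
rewrite inE => /andP[Pp' Pp].
have [x xP] : exists x, x \in P.
  by apply/set0Pn; apply: contraTneq Pp => ->.
have [y yx PE] := pairing_blockP pP Pp xP.
have xS : x \in S1 :|: S2 by rewrite -pcov; apply/bigcupP; exists P.
have P'p' : pblock p' x \in p' by rewrite pblock_mem // p'cov.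
have xP' : x \in pblock p' x by rewrite mem_pblock p'cov.
have [y' y'x P'E] := pairing_blockP p'P P'p' xP'.
have yy' : y != y' by apply: contraNneq Pp' => yy'; rewrite PE yy' -P'E.
have := @even_pairing_block p x y pE; rewrite -PE eq_sym => /(_ Pp yx)[s1 s2].
have := @even_pairing_block p' x y' p'E; rewrite -P'E eq_sym => /(_ P'p' y'x)[s1' s2'].
have e1 : (y \in S1) = (y' \in S1) by rewrite -s1.
have e2 : (y \in S2) = (y' \in S2) by rewrite -s2.
(* [y] and [y'] are the partners of [x] in [p] and in [p']. Exchanging them turns the block of [x]
   in [p'] into [P], and fixes every block common to [p] and [p'], since such a block contains
   neither. *)
pose s := tperm y y'; have s_inj : injective s by exact: perm_inj.
rewrite -(Finv y y' p' e1 e2); apply: IH; last 2 first.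
- by rewrite -(even_partitions_map s_inj) in p'E; rewrite !imset_tperm_id in p'E.
- by rewrite is_pairing_map.
apply: leq_trans kp; apply: proper_card; apply/properP; split.
  apply/subsetP => Q; rewrite !inE => /andP[Qs Qp]; rewrite Qp andbT.
  apply: contraNN Qs => Qp'.
  have QP : Q != P by apply: contraNneq Pp' => <-.
  have yQ : y \notin Q.
    apply: contraNN QP => yQ; rewrite -(def_pblock ptriv Qp yQ) (def_pblock ptriv Pp) //.
    by rewrite PE set22.
  have y'Q : y' \notin Q.
    apply: contraNN QP => y'Q.
    have QE : Q = pblock p' x.
      by rewrite -(def_pblock p'triv Qp' y'Q) (def_pblock p'triv P'p') // P'E set22.
    have xQ : x \in Q by rewrite QE.
    by rewrite -(def_pblock ptriv Qp xQ) (def_pblock ptriv Pp).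
  apply/imsetP; exists Q => //.
  by rewrite imset_tperm_id // (negPf yQ) (negPf y'Q).
exists P; first by rewrite inE Pp' Pp.
rewrite inE Pp andbT negbK; apply/imsetP; exists (pblock p' x) => //.
by rewrite P'E PE imsetU1 imset_set1 tpermR tpermD .
Qed.

End Pairings.

(** * The law of the cluster partition *)

(** Used with [x] = Z_2k, [z] = Z_0 and [m] the non-pairing weight: the lower bound on [x * l]
    consumes all but a fraction [1 - q] of the Gaussian upper bound. *)
Lemma scaled_defect (R : realFieldType) (x z m l a q : R) : 0 <= z ->
  (x * z + m) * l <= a * z ^+ 2 -> q * (a * z) <= x * l -> m * l <= a * (1 - q) * z ^+ 2.
Proof. by move=> z0 h1 h2; have := ler_wpM2r z0 h2; lra. Qed.

Section RhoTilde.
Context {R : realType}.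
Variables (n : nat) (lam : R).
Let d := dn n lam.
Hypothesis d_ge0 : 0 <= d.
Notation cur := (Kcurrent n).
Implicit Types (S : {set 'I_n}) (p : {set {set 'I_n}}).

Lemma partition_functionE S : partition_function lam S = pf d S.
Proof.
rewrite /partition_function /pf /mass esum_mkcond; congr fine; apply: eq_esum => m _.
have -> : (m \in [set m : cur | sources m = S]%classic) = (sources m == S).
  by apply/idP/eqP => [/set_mem|h] //; apply: mem_set.
by case: eqP => _; rewrite ?mulr1 ?mulr0.
Qed.

Lemma current_probE S (m : cur) :
  current_prob lam S m = (pf d S)^-1 * (wgt d m * (sources m == S)%:R).
Proof.
rewrite /current_prob partition_functionE; case: eqP => _; rewrite ?mulr1 ?mulr0 //.
by rewrite mulrC.
Qed.

Lemma rho_tildeE S1 S2 p : rho_tilde lam S1 S2 p =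
  (pf d S1)^-1 * (pf d S2)^-1 *
  pair_mass d S1 S2 (fun m => cluster_partition m (S1 :|: S2) == p).
Proof.
pose Q := fun m : cur => cluster_partition m (S1 :|: S2) == p.
have c0 : 0 <= (pf d S1)^-1 * (pf d S2)^-1 by rewrite mulr_ge0 ?invr_ge0 ?pf_ge0.
rewrite /rho_tilde -[RHS]/(fine (_ * pair_mass d S1 S2 Q)%:E) EFinM -pair_massE // -massZ //; last first.
  by move=> z; apply: pair_weight_ge0.
congr fine; rewrite /mass esum_mkcond; apply: eq_esum => z _.
have -> : (z \in [set m : cur * cur | cluster_partition (addc m.1 m.2) (S1 :|: S2) = p]%classic) = Q (addc z.1 z.2).
  by apply/idP/eqP => [/set_mem|h] //; apply: mem_set.
rewrite /current2_prob !current_probE /pair_weight.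
case: (Q _) => /=; last by rewrite !mulr0.
by rewrite mulr1 mulrACA.
Qed.

Lemma rho_tilde_ge0 S1 S2 p : 0 <= rho_tilde lam S1 S2 p.
Proof.
rewrite rho_tildeE !mulr_ge0 ?invr_ge0 ?pf_ge0 //.
by apply: fine_ge0; apply: mass_ge0 => z; apply: pair_weight_ge0.
Qed.

Lemma sum_rho_tilde S1 S2 (A : {set {set {set 'I_n}}}) :
  \sum_(p in A) rho_tilde lam S1 S2 p =
  (pf d S1)^-1 * (pf d S2)^-1 *
  pair_mass d S1 S2 (fun m => cluster_partition m (S1 :|: S2) \in A).
Proof.
under eq_bigr do rewrite rho_tildeE.
rewrite -mulr_sumr; congr (_ * _); apply: EFin_inj.
rewrite -sumEFin -pair_massE //.
under eq_bigr do rewrite -pair_massE //.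
rewrite -mass_sum; last by move=> p z; apply: pair_weight_ge0.
apply: eq_mass => z; rewrite /pair_weight -mulr_sumr; congr (_ * _).
set q := cluster_partition _ _; case: (boolP (q \in A)) => qA.
  rewrite (bigD1 q) //= eqxx big1 ?addr0 // => p /andP[_ /negPf].
  by rewrite eq_sym => ->.
by rewrite big1 // => p pA; case: eqP => // qp; rewrite qp pA in qA.
Qed.

(** Relabelling both currents by [s] preserves weights and source conditions, and transports the
    clusters. *)
Lemma rho_tilde_perm (s : {perm 'I_n}) S1 S2 p : s @: S1 = S1 -> s @: S2 = S2 ->
  rho_tilde lam S1 S2 (map_partition s p) = rho_tilde lam S1 S2 p.
Proof.
move=> s1 s2; rewrite !rho_tildeE; congr (_ * fine _).
have [r rK Kr] := relabel_bij s.
rewrite [RHS](@mass_reindex _ _ _ (fun z : cur * cur => (relabel s z.1, relabel s z.2))); last first.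
  by exists (fun z => (r z.1, r z.2)) => -[x y] /=; rewrite ?rK ?Kr.
apply: eq_mass => z; rewrite /pair_weight /= !wgt_relabel.
have src (m : cur) S : s @: S = S -> (sources (relabel s m) == S) = (sources m == S).
  by move=> sS; rewrite -(inj_eq (imset_inj (@perm_inj _ s)) (sources (relabel s m))) sources_relabel sS.
rewrite !src //; congr (_ * (nat_of_bool _)%:R).
have -> : addc (relabel s z.1) (relabel s z.2) = relabel s (addc z.1 z.2).
  by apply/ffunP => e; rewrite !ffunE.
rewrite -(inj_eq (map_partition_inj (@perm_inj _ s)) (cluster_partition (relabel s _) _)).
by rewrite {2}/map_partition cluster_partition_relabel imsetU s1 s2.
Qed.

Lemma rho_tilde_pairing S1 S2 p p' :
  p \in even_partitions S1 S2 -> is_pairing p ->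
  p' \in even_partitions S1 S2 -> is_pairing p' ->
  rho_tilde lam S1 S2 p = rho_tilde lam S1 S2 p'.
Proof.
apply: pairing_invariant => x y q e1 e2.
by apply: rho_tilde_perm; exact: imset_tperm_id.
Qed.

(** A cluster of the sum is closed under the links of each current separately, so it contains evenly
    many sources of each; all the mass thus sits on even partitions. *)
Lemma sum_rho_tilde_even S1 S2 : [disjoint S1 & S2] -> 0 < pf d S1 -> 0 < pf d S2 ->
  \sum_(p in even_partitions S1 S2) rho_tilde lam S1 S2 p = 1.
Proof.
move=> dS p1 p2; rewrite sum_rho_tilde.
have -> : pair_mass d S1 S2 (fun m => cluster_partition m (S1 :|: S2) \in even_partitions S1 S2) =
    pf d S1 * pf d S2.
  apply: EFin_inj; rewrite -pair_massE // -mass_pair_weight1 //; apply: eq_mass => z.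
  rewrite /pair_weight; case: (eqVneq (sources z.1) S1) => [h1|]; last by rewrite mulr0 !mul0r.
  case: (eqVneq (sources z.2) S2) => [h2|]; last by rewrite !(mulr0, mul0r).
  suff -> : cluster_partition (addc z.1 z.2) (S1 :|: S2) \in even_partitions S1 S2 by [].
  rewrite inE cluster_partitionP /=; apply/forall_inP => P Pp.
  apply/andP; split.
    rewrite -h1; apply: (even_cluster _ Pp); last by rewrite h1 subsetUl.
    by move=> x y xy; rewrite linked_addc xy.
  rewrite -h2; apply: (even_cluster _ Pp); last by rewrite h2 subsetUr.
  by move=> x y xy; rewrite linked_addc xy orbT.
by field; rewrite !gt_eqF.
Qed.

(** [nonpairing_bound] and the Gaussian bounds control the non-pairing weight by Z_0 squared. The
    lower bounds on the two partition functions, with [dfact >= 1], then turn Z_0 squared into the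
    normalization, losing one more factor [q ^+ k]. *)
Lemma sum_rho_tilde_nonpairing S1 S2 (t eta : R) k1 k2 :
  [disjoint S1 & S2] -> #|S1| = k1.*2 -> #|S2| = k2.*2 ->
  0 < lam -> 0 < t -> t ^+ 2 = n%:R -> d * t ^+ 2 = 1 - lam / t ->
  0 < eta -> 4 * eta < 1 -> lam <= eta * t ->
  (k1 + k2).*2%:R <= 3 * eta * t ^+ 2 ->
  5 * (k1 + k2).*2%:R + 9 <= 3 * eta * lam * t ->
  (k1 + k2).*2%:R + 3 <= 3 * eta * lam ^+ 2 -> ((k1 + k2).*2 <= n)%N ->
  [/\ 0 < pf d S1, 0 < pf d S2 &
  (1 - 4 * eta) ^+ (k1 + k2) *
    \sum_(p in [set p in even_partitions S1 S2 | ~~ is_pairing p]) rho_tilde lam S1 S2 p <=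
  (dfact (k1 + k2))%:R * (1 - (1 - 4 * eta) ^+ (k1 + k2))].
Proof.
move=> dS c1 c2 lam0 t0 tE dE e0 e1 H1 H2 H3 H4 kn; set k := (k1 + k2)%N in H2 H3 H4 kn *.
have tE' : t ^+ 2 = #|'I_n|%:R by rewrite card_ord.
have lamt : lam <= t by apply: le_trans H1 _; rewrite ler_piMl ?ltW //; lra.
set L := lam * t; have L0 : 0 < L by exact: mulr_gt0.
set q := 1 - 4 * eta; have q0 : 0 < q by rewrite /q; lra.
have q1 : q <= 1 by rewrite /q; lra.
have low j : (j <= k)%N -> q ^+ j * ((dfact j)%:R * @pf 'I_n R d set0) <= pfn 'I_n d j.*2 * L ^+ j.
  move=> jk; rewrite pf_pfn cards0.
  by apply: (@pfn_double_ge _ R d lam t lam0 t0 tE' lamt dE eta k); rewrite ?card_ord // ltW.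
have Lk j : 0 < L ^+ j by rewrite exprn_gt0.
have Z0 : 0 < @pf 'I_n R d set0 by exact: pf_set0_gt0.
have df j : 0 < (dfact j)%:R :> R by rewrite ltr0n dfact_gt0.
have df1 j : 1 <= (dfact j)%:R :> R by rewrite ler1n dfact_gt0.
have pos j : (j <= k)%N -> 0 < pfn 'I_n d j.*2.
  move=> jk; rewrite -(pmulr_lgt0 _ (Lk j)); apply: lt_le_trans (low j jk).
  by rewrite !mulr_gt0 // exprn_gt0.
have lk1 : (k1 <= k)%N by rewrite leq_addr.
have lk2 : (k2 <= k)%N by rewrite leq_addl.
have p1 : 0 < pf d S1 by rewrite pf_pfn c1 pos.
have p2 : 0 < pf d S2 by rewrite pf_pfn c2 pos.
split => //.
have cS : #|S1 :|: S2| = k.*2.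
  by rewrite cardsU (disjoint_setI0 dS) cards0 subn0 c1 c2 doubleD.
set M := pair_mass d S1 S2 (fun m => ~~ is_pairing (cluster_partition m (S1 :|: S2))).
have sM : \sum_(p in [set p in even_partitions S1 S2 | ~~ is_pairing p]) rho_tilde lam S1 S2 p <=
    (pf d S1)^-1 * (pf d S2)^-1 * M.
  rewrite sum_rho_tilde ler_wpM2l ?mulr_ge0 ?invr_ge0 ?pf_ge0 // -lee_fin -!pair_massE //.
  apply: le_mass => z; rewrite /pair_weight ler_wpM2l ?mulr_ge0 ?wgt_ge0 //.
  by rewrite ler_nat inE; case: (_ \in _) => //=; case: is_pairing.
have := nonpairing_bound d_ge0 dS cS; rewrite -/M => b1.
have := @sum_subsets_pf _ R d lam t lam0 t0 tE' lamt dE _ _ cS; rewrite -/L => b2.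
have two : 0 < (2 : R) ^+ k by rewrite exprn_gt0.
have b3 : (pf d (S1 :|: S2) * @pf 'I_n R d set0 + M) * L ^+ k <= (dfact k)%:R * @pf 'I_n R d set0 ^+ 2.
  rewrite -(ler_pM2l two) mulrA; apply: le_trans (ler_wpM2r (ltW (Lk k)) b1) _.
  by apply: le_trans b2 _; rewrite natrM natrX -mulrA pf_pfn cards0.
have b4 := low k (leqnn k); rewrite -cS -pf_pfn in b4.
have b5 : M * L ^+ k <= (dfact k)%:R * (1 - q ^+ k) * @pf 'I_n R d set0 ^+ 2.
  exact: (scaled_defect (ltW Z0) b3 b4).
have b6 : q ^+ k * @pf 'I_n R d set0 ^+ 2 <= pf d S1 * pf d S2 * L ^+ k.
  have l1 := low k1 lk1; have l2 := low k2 lk2; rewrite -c1 -pf_pfn in l1; rewrite -c2 -pf_pfn in l2.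
  have -> : pf d S1 * pf d S2 * L ^+ k = (pf d S1 * L ^+ k1) * (pf d S2 * L ^+ k2) by rewrite exprD; ring.
  have -> : q ^+ k * @pf 'I_n R d set0 ^+ 2 = (q ^+ k1 * @pf 'I_n R d set0) * (q ^+ k2 * @pf 'I_n R d set0).
    by rewrite exprD; ring.
  have qk j : 0 <= q ^+ j by rewrite exprn_ge0 // ltW.
  apply: ler_pM; rewrite ?mulr_ge0 ?(ltW Z0) //.
    by apply: le_trans l1; rewrite ler_wpM2l // ler_peMl // ltW.
  by apply: le_trans l2; rewrite ler_wpM2l // ler_peMl // ltW.
have qk0 : 0 < q ^+ k by rewrite exprn_gt0.
have qk1 : 0 <= 1 - q ^+ k by rewrite subr_ge0 exprn_ile1 // ltW.
have M0 : 0 <= M by apply: fine_ge0; apply: mass_ge0 => z; apply: pair_weight_ge0.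
have b7 : q ^+ k * M <= (dfact k)%:R * (1 - q ^+ k) * (pf d S1 * pf d S2).
  rewrite -(ler_pM2r (Lk k)) -[X in X <= _]mulrA.
  apply: le_trans (ler_wpM2l (ltW qk0) b5) _.
  have -> : q ^+ k * ((dfact k)%:R * (1 - q ^+ k) * @pf 'I_n R d set0 ^+ 2) =
    (dfact k)%:R * (1 - q ^+ k) * (q ^+ k * @pf 'I_n R d set0 ^+ 2) by ring.
  by rewrite -[X in _ <= X]mulrA ler_wpM2l // mulr_ge0 // ltW.
apply: le_trans (ler_wpM2l (ltW qk0) sM) _.
have -> : q ^+ k * ((pf d S1)^-1 * (pf d S2)^-1 * M) = (q ^+ k * M) / (pf d S1 * pf d S2).
  by field; rewrite !gt_eqF.
by rewrite ler_pdivrMr ?mulr_gt0.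
Qed.

End RhoTilde.

(** * Passage to the limit *)

(** If s is the mass outside [Q], a point outside has mass at most s, while the N points of [Q]
    share 1 - s equally and so miss 1 / N by s / N. *)
Lemma near_uniform (R : realFieldType) (X : finType) (A : {set X}) (Q : pred X)
    (r : X -> R) (delta : R) :
  (forall p, p \in A -> 0 <= r p) -> \sum_(p in A) r p = 1 ->
  \sum_(p in [set p in A | ~~ Q p]) r p <= delta ->
  (forall p p', p \in A -> Q p -> p' \in A -> Q p' -> r p = r p') ->
  forall p, p \in A ->
    `|r p - (if Q p then #|[set p in A | Q p]|%:R^-1 else 0)| <= delta.
Proof.
move=> r0 r1 rN rQ p pA; set N := #|_|.
have sN0 : 0 <= \sum_(p in [set p in A | ~~ Q p]) r p.
  by apply: sumr_ge0 => q; rewrite inE => /andP[qA _]; exact: r0.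
case: ifPn => Qp; last first.
  rewrite subr0 ger0_norm ?r0 //; apply: le_trans rN.
  rewrite (bigD1 p) ?inE ?pA //= lerDl; apply: sumr_ge0 => q /andP[].
  by rewrite inE => /andP[/r0].
have N0 : (0 < N)%N by rewrite /N card_gt0; apply/set0Pn; exists p; rewrite inE pA.
have sQ : N%:R * r p + \sum_(p in [set p in A | ~~ Q p]) r p = 1.
  apply: etrans r1; rewrite [RHS](bigID Q) /=; congr (_ + _); last by apply: eq_bigl => q; rewrite inE.
  have -> : \sum_(i in A | Q i) r i = \sum_(i in A | Q i) r p.
    by apply: eq_bigr => i /andP[iA Qi]; exact: rQ.
  rewrite sumr_const mulr_natl; congr (_ *+ _).
  by rewrite /N; apply: eq_card => q; rewrite !inE.
have NR : 0 < N%:R :> R by rewrite ltr0n.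
have -> : r p - N%:R^-1 = - (\sum_(p in [set p in A | ~~ Q p]) r p / N%:R).
  have -> : r p = (1 - \sum_(p in [set p in A | ~~ Q p]) r p) / N%:R.
    have <- : N%:R * r p = 1 - \sum_(p in [set p in A | ~~ Q p]) r p.
      by apply/eqP; rewrite eq_sym subr_eq sQ.
    by rewrite mulrC mulKf // gt_eqF.
  by rewrite -mulr_suml; field; rewrite gt_eqF.
rewrite normrN -mulr_suml ger0_norm ?mulr_ge0 ?invr_ge0 ?ler0n //.
apply: le_trans rN; rewrite ler_piMr // invf_le1 //.
by rewrite ler1n.
Qed.

Lemma bernoulli_inequality (R : realFieldType) (x : R) k : 0 <= x <= 1 -> 1 - k%:R * x <= (1 - x) ^+ k.
Proof.
move=> /andP[x0 x1]; elim: k => [|k IH]; first by rewrite expr0 mul0r subr0.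
rewrite exprS; have y0 : 0 <= 1 - x by lra.
apply: le_trans (ler_wpM2l y0 IH); rewrite -addn1 natrD.
have : 0 <= k%:R * x * x by rewrite !mulr_ge0.
lra.
Qed.

Lemma rho_tilde_near_uniform (R : realType) (T : finType) (S1 S2 : {set T}) k1 k2 (eps : R) :
  [disjoint S1 & S2] -> #|S1| = k1.*2 -> #|S2| = k2.*2 -> 0 < eps ->
  exists2 Lam : R, 0 < Lam & forall lam, Lam <= lam ->
    exists N : R, forall n, N <= n%:R -> forall f : T -> 'I_n, injective f ->
    forall p, p \in even_partitions S1 S2 ->
    `|rho_tilde lam (f @: S1) (f @: S2) (map_partition f p) -
      (if is_pairing p then #|[set p in even_partitions S1 S2 | is_pairing p]|%:R^-1 else 0)| <= eps.
Proof.
move=> dS c1 c2 eps0; set k := (k1 + k2)%N.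
pose F : R := (dfact k)%:R; have F0 : 0 < F by rewrite ltr0n dfact_gt0.
(* The solution of F delta = eps (1 - delta): once [q >= 1 - delta], the bound [F * (1 - q) / q] is
   at most [eps]. *)
pose delta := eps / (F + eps).
have Fe : 0 < F + eps by rewrite addr_gt0.
have delta0 : 0 < delta by rewrite divr_gt0.
have delta1 : delta < 1 by rewrite ltr_pdivrMr // mul1r ltrDr.
pose k' : R := k%:R; have k'0 : 0 <= k' by [].
(* By Bernoulli, [4 * k' * eta <= delta] gives [q >= 1 - delta]; the added 1 covers [k = 0] and
   yields [4 * eta < 1]. *)
pose eta := delta / (4 * (k' + 1)).
have e0 : 0 < eta by rewrite divr_gt0 // mulr_gt0 // ltr_wpDl.
have etaE : eta * (4 * (k' + 1)) = delta.
  by rewrite /eta mulfVK // gt_eqF // mulr_gt0 // ltr_wpDl.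
have ke0 : 0 <= k' * eta by rewrite mulr_ge0 // ltW.
have e1 : 4 * eta < 1 by lra.
pose q := (1 - 4 * eta) ^+ k.
have q_ge : 1 - delta <= q.
  apply: le_trans (bernoulli_inequality k _); last by apply/andP; split; lra.
  by rewrite -/k'; lra.
have q_gt0 : 0 < q by apply: lt_le_trans q_ge; lra.
have Fq : F * (1 - q) <= eps * q.
  have : (F + eps) * (1 - delta) <= (F + eps) * q by rewrite ler_wpM2l // ltW.
  have : (F + eps) * delta = eps by rewrite /delta mulrC mulfVK // gt_eqF.
  lra.
have K0 : 0 <= k.*2%:R :> R by [].
pose K : R := k.*2%:R.
(* The first summand gives [K + 3 <= 3 * eta * lam], and the 1 gives [lam >= 1], which upgrades
   [lam] to its square. *)
exists ((K + 3) / (3 * eta) + 1).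
  by rewrite ltr_wpDl // divr_ge0 ?addr_ge0 // mulr_ge0 // ltW.
move=> lam lamL.
have lam1 : 1 <= lam by apply: le_trans lamL; rewrite lerDr divr_ge0 ?addr_ge0 // mulr_ge0 // ltW.
have lam0 : 0 < lam by lra.
have e3 : 0 < 3 * eta by rewrite mulr_gt0.
have H4 : K + 3 <= 3 * eta * lam ^+ 2.
  have : (K + 3) / (3 * eta) <= lam by lra.
  rewrite ler_pdivrMr // => h; apply: le_trans h _.
  have -> : 3 * eta * lam ^+ 2 = lam * (3 * eta) * lam by ring.
  by apply: ler_peMr => //; apply: mulr_ge0; exact: ltW.
(* All summands are nonnegative. The first three serve the size conditions on [t], the root of [n];
   [K] ensures enough vertices, and 1 ensures [t <= t ^+ 2]. *)
pose t0 := lam / eta + (5 * K + 9) / (3 * eta * lam) + K / (3 * eta) + K + 1.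
have a1 : 0 <= lam / eta by rewrite divr_ge0 // ltW.
have el0 : 0 < 3 * eta * lam by rewrite mulr_gt0.
have a2 : 0 <= (5 * K + 9) / (3 * eta * lam).
  by rewrite divr_ge0 ?(ltW el0) // addr_ge0 // mulr_ge0.
have a3 : 0 <= K / (3 * eta) by rewrite divr_ge0 // ltW.
exists (t0 ^+ 2) => n nt0 f f_inj p pE.
pose t := Num.sqrt (n%:R : R).
have K0' : 0 <= K by exact: K0.
have t00 : 0 <= t0 by rewrite /t0; lra.
have tt0 : t0 <= t by rewrite -[X in X <= _]ger0_norm // -sqrtr_sqr ler_wsqrtr.
have tE : t ^+ 2 = n%:R by rewrite sqr_sqrtr.
have t1 : 1 <= t by apply: le_trans tt0; rewrite /t0; lra.
have t_gt0 : 0 < t by lra.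
have H1 : lam <= eta * t.
  by rewrite mulrC -ler_pdivrMr //; apply: le_trans tt0; rewrite /t0; lra.
have tt2 : t <= t ^+ 2 by rewrite expr2 ler_peMr // ltW.
have H2 : K <= 3 * eta * t ^+ 2.
  have : K / (3 * eta) <= t ^+ 2 by apply: (le_trans _ tt2); apply: (le_trans _ tt0); rewrite /t0; lra.
  by rewrite ler_pdivrMr // mulrC.
have H3 : 5 * K + 9 <= 3 * eta * lam * t.
  have : (5 * K + 9) / (3 * eta * lam) <= t by apply: (le_trans _ tt0); rewrite /t0; lra.
  by rewrite ler_pdivrMr // [t * _]mulrC.
have H5 : (k.*2 <= n)%N.
  rewrite -(ler_nat R) -tE -/K; apply: (le_trans _ tt2); apply: (le_trans _ tt0); rewrite /t0; lra.
have nE : (n%:R : R) != 0 by rewrite -tE gt_eqF // exprn_gt0.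
have dE : dn n lam * t ^+ 2 = 1 - lam / t.
  by rewrite /dn tE mulrAC mulVf // mul1r.
have d_ge0 : 0 <= dn n lam.
  rewrite /dn mulr_ge0 ?invr_ge0 // -/t subr_ge0 ler_pdivrMr // mul1r.
  by apply: le_trans H1 _; rewrite ler_piMl ?ltW //; lra.
have dS' : [disjoint f @: S1 & f @: S2] by rewrite imset_disjoint.
case: (@sum_rho_tilde_nonpairing R n lam d_ge0 (f @: S1) (f @: S2) t eta k1 k2 dS') => //;
  [by rewrite card_imset | by rewrite card_imset | ].
move=> pf1 pf2 bound.
have imE : even_partitions (f @: S1) (f @: S2) =
    map_partition f @: even_partitions S1 S2.
  apply/setP => r; apply/idP/imsetP => [/(map_partition_surj f_inj)[r' ? ->]|[r' ? ->]].
    by exists r'.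
  by rewrite even_partitions_map.
have m_inj := map_partition_inj f_inj.
apply: (@near_uniform _ _ (even_partitions S1 S2) (@is_pairing T)
  (fun p => rho_tilde lam (f @: S1) (f @: S2) (map_partition f p))) => //.
- by move=> r _; exact: rho_tilde_ge0.
- rewrite -(sum_rho_tilde_even d_ge0 dS' pf1 pf2) imE big_imset //.
  by move=> ? ? _ _; exact: m_inj.
- have -> : \sum_(r in [set r in even_partitions S1 S2 | ~~ is_pairing r])
      rho_tilde lam (f @: S1) (f @: S2) (map_partition f r) =
    \sum_(r in [set r in even_partitions (f @: S1) (f @: S2) | ~~ is_pairing r])
      rho_tilde lam (f @: S1) (f @: S2) r.
    rewrite -(big_imset (fun r => rho_tilde lam (f @: S1) (f @: S2) r)) /=; last by move=> ? ? _ _; exact: m_inj.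
    apply: eq_bigl => r; rewrite [RHS]inE imE; apply/imsetP/andP.
      by case=> r'; rewrite inE => /andP[r'E r'P] ->; rewrite is_pairing_map // imset_f.
    by case=> /imsetP[r' r'E ->]; rewrite is_pairing_map // => r'P; exists r'; rewrite // inE r'E.
  rewrite -(ler_pM2l q_gt0); apply: le_trans bound _.
  by rewrite -/k -/q -/F [q * _]mulrC.
- move=> r r' rE rP r'E r'P; apply: rho_tilde_pairing => //.
  + by rewrite even_partitions_map.
  + by rewrite is_pairing_map.
  + by rewrite even_partitions_map.
  + by rewrite is_pairing_map.
Qed.

(** * Blocks at a vertex and the limit in g *)

Section Blocks.
Variables (V : finType) (E : {set {set V}}) (n1 n2 : current E) (A B : V -> nat) (x : V).

Lemma card_block (m : current E) (C : V -> nat) : #|block x m C| = (degree m x + C x)%N.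
Proof.
rewrite card_sum card_ord card_tagged sumnE big_map big_enum /=; congr (_ + _)%N.
by apply: eq_bigr => y _; rewrite card_ord.
Qed.

Lemma card_block_double (m : current E) (C : V -> nat) : sources m = bdry C ->
  exists k, #|block x m C| = k.*2.
Proof.
move=> h; exists (#|block x m C|)./2; rewrite -[LHS]odd_double_half card_block oddD.
have -> : odd (degree m x) = odd (C x) by move/setP/(_ x): h; rewrite !inE.
by rewrite addbb.
Qed.

Lemma card_block_left : #|block_left n1 n2 A B x| = #|block x n1 A|.
Proof. by rewrite card_imset // => ? ? []. Qed.

Lemma card_block_right : #|block_right n1 n2 A B x| = #|block x n2 B|.
Proof. by rewrite card_imset // => ? ? []. Qed.

Lemma disjoint_blocks : [disjoint block_left n1 n2 A B x & block_right n1 n2 A B x].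
Proof.
by rewrite -setI_eq0; apply/eqP/setP => z; rewrite !inE; apply/negP => /andP[/imsetP[? _ ->] /imsetP[]].
Qed.

Lemma card_tangling_pairings :
  #|[set s : tangling n1 n2 A B x | is_pairing (val s)]| =
  #|[set p in even_partitions (block_left n1 n2 A B x) (block_right n1 n2 A B x) | is_pairing p]|.
Proof.
rewrite -(card_imset _ val_inj); apply: eq_card => p; rewrite [RHS]inE.
apply/imsetP/andP => [[s]|[pE pP]].
  by rewrite inE => sP ->; split => //; exact: valP.
by exists (Sub p pE : tangling n1 n2 A B x); rewrite ?inE.
Qed.

Lemma place_imset (iota : block2 n1 n2 A B x -> nat) n (lt_n : forall t, (iota t < n)%N) P :
  place iota n P = [set Ordinal (lt_n t) | t in P].
Proof.
apply/setP => v; rewrite inE; apply/exists_inP/imsetP => [[t tP /eqP tv]|[t tP ->]].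
  by exists t => //; apply: val_inj.
by exists t.
Qed.

End Blocks.

Lemma near_lambda_ga_ge (R : realType) (a Lam : R) : 0 < a -> 0 < Lam ->
  (\forall g \near (0 : R)^'+, Lam <= lambda_ga g a)%classic.
Proof.
move=> a0 L0; near=> g.
have g0 : 0 < g by near: g; exact: nbhs_right_gt.
have gl : g < (2 * a / Lam) ^+ 2 / 12.
  near: g; apply: nbhs_right_lt.
  by rewrite divr_gt0 // exprn_gt0 // divr_gt0 // mulr_gt0.
rewrite /lambda_ga; set u := (12 * g) `^ 4^-1.
have u0 : 0 < u by apply: powR_gt0; rewrite mulr_gt0.
have u4 : u ^+ 4 = 12 * g.
  by rewrite -powR_mulrn ?ltW // /u -powRrM mulVf // powRr1 // mulr_ge0 // ltW.
rewrite ler_pdivlMr ?exprn_gt0 // mulrC -ler_pdivlMr //.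
have c0 : 0 <= 2 * a / Lam by rewrite divr_ge0 ?mulr_ge0 // ltW.
rewrite -(@ler_pXn2r _ 2) ?nnegrE ?exprn_ge0 ?(ltW u0) // -exprM u4.
by rewrite mulrC -ler_pdivlMr // ltW.
Unshelve. all: by end_near. Qed.

Lemma cvg_finite_sum (R : realType) (I X : Type) (F : set_system I) (FF : Filter F)
    (r : seq X) (f : I -> X -> R) (l : X -> R) :
  (forall t, (f i t @[i --> F] --> l t)%classic) ->
  ((fun i => \sum_(t <- r) f i t) @ F --> \sum_(t <- r) l t)%classic.
Proof.
move=> fl; elim: r => [|t r IH].
  have -> : (fun i => \sum_(t <- [::]) f i t) = (fun=> 0) by apply/funext => i; rewrite big_nil.
  by rewrite big_nil; exact: cvg_cst.
have -> : (fun i => \sum_(s <- t :: r) f i s) = (fun i => f i t + \sum_(s <- r) f i s).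
  by apply/funext => i; rewrite big_cons.
by rewrite big_cons; apply: cvgD.
Qed.

Theorem proposition4p6 (R : realType) (V : finType) (E : {set {set V}})
  (graphE : E \subset pairs V)
  (A B : V -> nat) (evenA : even_total A) (evenB : even_total B)
  (n1 n2 : current E)
  (bdry1 : sources n1 = bdry A) (bdry2 : sources n2 = bdry B)
  (a : R) (a_gt0 : 0 < a) (x : V)
  (rho : R -> tangling n1 n2 A B x -> R)
  (rhoE : forall g : R, 0 < g -> is_rho g a (rho g)) :
  cvg_in_distribution (0 : R)^'+%classic rho
    (@uniform_pairing V E n1 n2 A B x R).
Proof.
have [k1 c1] := card_block_double x bdry1; rewrite -(card_block_left n1 n2 A B) in c1.
have [k2 c2] := card_block_double x bdry2; rewrite -(card_block_right n1 n2 A B) in c2.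
(* The space of tanglings is finite, so convergence of each point mass suffices. *)
move=> phi; apply: cvg_finite_sum => t; apply: cvgM; last exact: cvg_cst.
apply/cvgrPdistC_le => eps eps0.
have [Lam Lam0 near_n] := rho_tilde_near_uniform (disjoint_blocks n1 n2 A B x) c1 c2 eps0.
near=> g.
have g0 : 0 < g by near: g; exact: nbhs_right_gt.
have Lg : Lam <= lambda_ga g a by near: g; exact: near_lambda_ga_ge.
have [iota iota_inj rho_lim] := rhoE g g0.
have {}rho_lim : (rho_n iota (lambda_ga g a) n t @[n --> \oo] --> rho g t)%classic.
  (* Testing against indicators recovers the point masses from convergence in distribution. *)
  have ind (mu : tangling n1 n2 A B x -> R) : expect mu (fun s => (s == t)%:R) = mu t.
    rewrite /expect (bigD1 t) //= eqxx mulr1 big1 ?addr0 // => s /negPf ->.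
    by rewrite mulr0.
  have := rho_lim (fun s => (s == t)%:R); rewrite ind.
  by under eq_fun do rewrite ind.
have [N Nn] := near_n _ Lg.
(* For fixed [g] the bound [eps] holds for all large [n]; being a closed condition, it passes to the
   limit. *)
apply: (@cvgr_to_le _ \oo%classic _ _ (fun n => `|rho_n iota (lambda_ga g a) n t - uniform_pairing R t|)).
  by apply: cvg_norm; apply: cvgB => //; exact: cvg_cst.
near=> n.
have nN : N <= n%:R by near: n; exact: nbhs_infty_ger.
(* Beyond the values of [iota], [place] is the image under an injection into the vertices. *)
have lt_n s : (iota s < n)%N.
  have : (\max_s iota s < n)%N by near: n; exact: nbhs_infty_gt.
  by apply: leq_ltn_trans; exact: leq_bigmax.
pose f s := Ordinal (lt_n s).
have f_inj : injective f by move=> s s' [] /iota_inj.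
have := Nn n nN f f_inj (val t) (valP t).
rewrite /rho_n /uniform_pairing !(place_imset lt_n) card_tangling_pairings.
suff -> : place iota n @: val t = map_partition f (val t) by [].
by apply: eq_imset => P; exact: place_imset.
Unshelve. all: by end_near. Qed.
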